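(* Let $A$ and $B$ be unital $C^*$-algebras with essential socle, and assume that $B$ is prime. Let $T:A\to B$ be a surjective linear map and let $h=T(\mathbf{1})$. The following conditions are equivalent: (1) for every $a,b\in A$, $a\leq_\diamond b$ if and only if $T(a)\leq_\diamond T(b)$; (2) $hh^*=h^*h=\lambda\mathbf{1}$ for some real number $\lambda>0$, and $T=hS$ (that is, $T(x)=hS(x)$ for all $x\in A$), where $S:A\to B$ is either a $^*$-isomorphism or a $^*$-anti-isomorphism.
   Context: All algebras are complex; $\mathbf{1}$ denotes the identity element. For elements $a,b$ of a unital $C^*$-algebra $A$, the diamond relation is defined by: $a\leq_\diamond b$ if and only if $aA\subseteq bA$, $Aa\subseteq Ab$ and $aa^*a=ab^*a$. The socle $\mathrm{Soc}(A)$ is the sum of all minimal left ideals (equivalently, of all minimal right ideals) of $A$. A nonzero ideal $I$ of $A$ is essential if it has nonzero intersection with every nonzero ideal of $A$; equivalently (for $C^*$-algebras), for $a\in A$, $aI=0$ implies $a=0$. ''$A$ has essential socle'' means $\mathrm{Soc}(A)$ is an essential ideal. *)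

(* Defs.v *)
From HB Require Import structures.
From mathcomp Require Import all_boot all_order all_algebra.
From mathcomp Require Import all_classical all_reals all_analysis.
From mathcomp Require Import complex.

Set Implicit Arguments.
Unset Strict Implicit.
Unset Printing Implicit Defensive.

Import Order.TTheory GRing.Theory Num.Theory.
Import numFieldNormedType.Exports.

Local Open Scope classical_set_scope.
Local Open Scope ring_scope.
Local Open Scope complex_scope.

(* The norm is a field of the structure, rather than inherited from
   normedModType, because Hierarchy Builder cannot join the ring and the normed
   module hierarchies below numDomainType. *)
HB.mixin Record isCStarAlgebra (R : realType) A & GRing.Algebra R[i] A := {
  cstar_norm : A -> R;
  cstar_norm_triangle :
    forall x y : A, cstar_norm (x + y) <= cstar_norm x + cstar_norm y;
  cstar_normZ : forall (c : R[i]) (x : A),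
    cstar_norm (c *: x) = Normc.normc c * cstar_norm x;
  cstar_norm_eq0 : forall x : A, cstar_norm x = 0 -> x = 0;
  cstar_normM :
    forall x y : A, cstar_norm (x * y) <= cstar_norm x * cstar_norm y;
  cstar_complete : forall u : nat -> A,
    (forall e : R, 0 < e -> exists N : nat,
       forall m n : nat, (N <= m)%N -> (N <= n)%N ->
         cstar_norm (u m - u n) < e) ->
    exists l : A, (cstar_norm (u n - l) @[n --> \oo]) --> (0 : R);
  star : A -> A;
  starK : involutive star;
  starD : {morph star : x y / x + y};
  starZ : forall (c : R[i]) (x : A), star (c *: x) = c^* *: star x;
  starM : forall x y : A, star (x * y) = star y * star x;
  cstar_normE : forall x : A, cstar_norm (star x * x) = cstar_norm x ^+ 2
}.

#[short(type="cstarAlgType")]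
HB.structure Definition CStarAlgebra (R : realType) :=
  {A of GRing.Algebra R[i] A & isCStarAlgebra R A}.

Definition diamond_le (R : realType) (A : cstarAlgType R) (a b : A) : Prop :=
  [/\ [set a * x | x in [set: A]] `<=` [set b * x | x in [set: A]],
      [set x * a | x in [set: A]] `<=` [set x * b | x in [set: A]] &
      a * star a * a = a * star b * a].

Section Ideals.
Variable A : nzRingType.
Implicit Types I J L : set A.

(* In a unital algebra, closure under scalars and opposites is automatic. *)
Definition left_ideal I : Prop :=
  [/\ I 0, (forall x y, I x -> I y -> I (x + y))
    & (forall a x, I x -> I (a * x))].

Definition two_sided_ideal I : Prop :=
  left_ideal I /\ (forall x a, I x -> I (x * a)).

Definition nonzero_set I : Prop := exists2 x, I x & x != 0.

Definition minimal_left_ideal L : Prop :=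
  [/\ left_ideal L, nonzero_set L
    & forall J, left_ideal J -> nonzero_set J -> J `<=` L -> J = L].

Definition socle : set A :=
  [set x | exists2 s : seq A,
      (forall y, y \in s -> exists2 L, minimal_left_ideal L & L y)
    & x = \sum_(y <- s) y].

Definition essential_ideal I : Prop :=
  [/\ two_sided_ideal I, nonzero_set I
    & forall J, two_sided_ideal J -> nonzero_set J -> nonzero_set (I `&` J)].

Definition has_essential_socle : Prop := essential_ideal socle.

Definition prime_ring : Prop :=
  forall I J, two_sided_ideal I -> two_sided_ideal J ->
    (forall x y, I x -> J y -> x * y = 0) ->
    I = [set 0] \/ J = [set 0].

End Ideals.

Arguments has_essential_socle A : clear implicits.
Arguments prime_ring A : clear implicits.

Definition star_isomorphism (R : realType) (A B : cstarAlgType R)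
    (S : A -> B) : Prop :=
  [/\ linear S, bijective S, {morph S : x y / x * y}
    & {morph S : x / star x}].

Definition star_anti_isomorphism (R : realType) (A B : cstarAlgType R)
    (S : A -> B) : Prop :=
  [/\ linear S, bijective S, (forall x y, S (x * y) = S y * S x)
    & {morph S : x / star x}].

(* Main.v *)
(* The socle enters through rank-one elements: u <> 0 with u A u = C u.  In the
   presence of an essential socle they are exactly the minimal nonzero elements
   for the diamond order, so T preserves them in both directions.  For u of rank
   one and b invertible, u <= b only says u b* u = u u* u; since such b are
   plentiful, T preserves the coefficient of u b* u along u u* u, for every b.
   Hence T preserves orthogonality and adjacency to u, that is, the Peirce
   decomposition of A with respect to u, and maps the Jordan triple product
   {x,y,z} = x y* z + z y* x to itself up to a constant rho, first for x of rank
   one, then for all x by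
     u {x,y,z}* u = {u, x, {y, z, u}} - {u x* u, z, y}.
   Primeness of B makes rho constant.  With h = T 1 one gets h h* = h* h = rho,
   and S = rho^-1 h* T is a unital Jordan *-homomorphism onto a prime ring, hence
   multiplicative or anti-multiplicative. *)

Require Import Defs.
From HB Require Import structures.
From mathcomp Require Import all_boot all_order all_algebra.
From mathcomp Require Import all_classical all_reals all_analysis.
From mathcomp Require Import complex.
From mathcomp Require Import ring lra.

Import Order.TTheory GRing.Theory Num.Theory.
Import numFieldNormedType.Exports.

Local Open Scope classical_set_scope.
Local Open Scope ring_scope.

Set Implicit Arguments.
Unset Strict Implicit.
Unset Printing Implicit Defensive.

(** * Norm and Neumann series *)

Section CStarBasics.
Variables (R : realType) (A : cstarAlgType R).
Implicit Types (a b u v w x y z : A) (c d : R[i]).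

Local Notation "`| x |" := (cstar_norm x) : ring_scope.
Local Notation "x ^†" := (star x) (at level 2, format "x ^†").

Lemma star0 : (0 : A)^† = 0.
Proof. by apply: (addrI (0^†)); rewrite -starD !addr0. Qed.

Lemma star_scale c x : (c *: x)^† = c^* *: x^†.
Proof. exact: starZ. Qed.

Lemma starN x : (- x)^† = - x^†.
Proof. by apply: (addrI (x^†)); rewrite -starD !subrr star0. Qed.

Lemma starB x y : (x - y)^† = x^† - y^†.
Proof. by rewrite starD starN. Qed.

Lemma star1 : (1 : A)^† = 1.
Proof. by rewrite -[LHS]mul1r -{1}[1]starK -starM mul1r starK. Qed.

Lemma star_eq0 x : (x^† == 0) = (x == 0).
Proof.
by apply/eqP/eqP=> [h|->]; [rewrite -[x]starK h star0 | rewrite star0].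
Qed.

Lemma norm0 : `|0 : A| = 0.
Proof. by rewrite -[0 in LHS](scale0r (0 : A)) cstar_normZ Normc.normc0 mul0r. Qed.

Lemma normN x : `|- x| = `|x|.
Proof. by rewrite -scaleN1r cstar_normZ (normcN (1 : R[i])) Normc.normc1 mul1r. Qed.

Lemma norm_ge0 x : 0 <= `|x|.
Proof.
have := cstar_norm_triangle x (- x); rewrite subrr norm0 normN => h.
by rewrite -(pmulrn_lge0 _ (n:=2)) // mulr2n.
Qed.

Lemma norm_gt0 x : x != 0 -> 0 < `|x|.
Proof.
move=> x0; rewrite lt_neqAle norm_ge0 andbT eq_sym.
by apply: contra x0 => /eqP/cstar_norm_eq0 ->.
Qed.

Lemma norm1 : `|1 : A| = 1.
Proof.
have n1 : `|1 : A| != 0 by rewrite gt_eqF // norm_gt0 // oner_neq0.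
have := cstar_normE (1 : A); rewrite star1 mulr1 expr2.
by move=> /esym h; apply: (mulfI n1); rewrite h mulr1.
Qed.

Lemma star_mul_eq0 x : x^† * x = 0 -> x = 0.
Proof.
move=> h; apply: cstar_norm_eq0; apply/eqP.
by rewrite -sqrf_eq0 -cstar_normE h norm0.
Qed.

Lemma mul_star_eq0 x : x * x^† = 0 -> x = 0.
Proof.
by move=> h; apply/eqP; rewrite -star_eq0; apply/eqP/star_mul_eq0; rewrite starK.
Qed.

Lemma mul_star_mul_eq0 x : x * x^† * x = 0 -> x = 0.
Proof.
move=> h; apply: star_mul_eq0; apply: star_mul_eq0.
by rewrite starM starK -!mulrA [x * _]mulrA h mulr0.
Qed.

Lemma starX x n : (x ^+ n)^† = x^† ^+ n.
Proof. by elim: n => [|n IHn]; rewrite ?expr0 ?star1 // exprSr starM IHn exprS. Qed.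

(** Induction by squaring: for y normal, the C*-identity makes the squared norm of y y the norm of
    y* y* y y, which normality rearranges into (y* y)* (y* y); the C*-identity then yields the
    fourth power of the norm of y. *)
Lemma norm_expr_normal x (k : nat) :
  x^† * x = x * x^† -> `|x ^+ (2 ^ k)| = `|x| ^+ (2 ^ k).
Proof.
move=> nx; elim: k => [|k IH]; first by rewrite !expr1.
rewrite expnS mulnC !exprM -IH.
have ny : (x ^+ (2 ^ k))^† * x ^+ (2 ^ k) = x ^+ (2 ^ k) * (x ^+ (2 ^ k))^†.
  rewrite starX; apply: commrX; apply/commr_sym; apply: commrX.
  exact/commr_sym.
move: (x ^+ (2 ^ k)) ny => y ny.
apply/eqP; rewrite -(eqrXn2 (n:=2)) // ?norm_ge0 ?exprn_ge0 ?norm_ge0 //.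
have -> : `|y| ^+ 2 ^+ 2 = `|(y^† * y)^† * (y^† * y)|
  by rewrite cstar_normE cstar_normE.
rewrite -cstar_normE [y ^+ 2]expr2 !starM starK -!mulrA.
by have -> : y^† * (y * y) = y * (y^† * y) by rewrite !mulrA ny.
Qed.

Lemma norm_triangleB x y : `|x - y| <= `|x| + `|y|.
Proof. by rewrite -(normN y); exact: cstar_norm_triangle. Qed.

Lemma normX x n : `|x ^+ n| <= `|x| ^+ n.
Proof.
elim: n => [|n IH]; first by rewrite !expr0 norm1.
rewrite !exprS; apply: le_trans (cstar_normM _ _) _.
by rewrite ler_wpM2l ?norm_ge0.
Qed.

Definition invertible x := exists y, y * x = 1 /\ x * y = 1.

Lemma half_expr_lt (e : R) : 0 < e ->
  exists N, forall n, (N <= n)%N -> 2^-1 ^+ n < e.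
Proof.
move=> e0; have : (2^-1 : R) ^+ n @[n --> \oo] --> (0 : R).
  by apply: cvg_expr; rewrite ger0_norm; lra.
move=> /cvgrPdist_lt/(_ _ e0)[N _ hN]; exists N => n /hN /=.
by rewrite sub0r normrN ger0_norm // exprn_ge0 //; lra.
Qed.

Lemma neumann x : `|x| <= 2^-1 -> invertible (1 - x).
Proof.
move=> xle; pose u n := \sum_(i < n) x ^+ i.
have uS n : u n.+1 = u n + x ^+ n by rewrite /u big_ord_recr.
have xn n : `|x ^+ n| <= 2^-1 ^+ n.
  by apply: le_trans (normX _ _) _; rewrite lerXn2r ?nnegrE ?norm_ge0 ?invr_ge0.
(* The bound is the exact geometric sum of [2^-1 ^+ i] for i from n to n + k - 1. *)
have ud n k : `|u (n + k)%N - u n| <= 2 * 2^-1 ^+ n - 2 * 2^-1 ^+ (n + k).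
  elim: k => [|k IH]; first by rewrite addn0 !subrr norm0.
  rewrite addnS uS addrAC; apply: le_trans (cstar_norm_triangle _ _) _.
  have := xn (n + k)%N; rewrite exprS; move: IH; lra.
have expu n : (1 - x) * u n = 1 - x ^+ n /\ u n * (1 - x) = 1 - x ^+ n.
  elim: n => [|n [IH1 IH2]]; first by rewrite /u big_ord0 mulr0 mul0r subrr.
  by split; rewrite uS; [rewrite mulrDr IH1 mulrBl mul1r -exprS
    | rewrite mulrDl IH2 mulrBr mulr1 -exprSr]; rewrite addrA subrK.
have [l hl] : exists l : A, (`|u n - l| @[n --> \oo]) --> (0 : R).
  apply: cstar_complete => e e0.
  (* Two later terms are each within [2 * 2^-1 ^+ N] of [u N], whence the quarter of [e]. *)
  have [N hN] := @half_expr_lt (e / 4) ltac:(lra).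
  have uN n : (N <= n)%N -> `|u n - u N| <= 2 * 2^-1 ^+ N.
    move=> /subnKC <-; apply: le_trans (ud _ _) _.
    by rewrite lerBlDr lerDl mulr_ge0 // exprn_ge0 //; lra.
  exists N => m n /uN hm /uN hn; have := hN N (leqnn N).
  have -> : u m - u n = (u m - u N) - (u n - u N) by rewrite opprB addrA subrK.
  move: (norm_triangleB (u m - u N) (u n - u N)) hm hn; lra.
(* Passage to the limit: the right-hand side tends to 0. It turns the approximate inverses [u n]
   into the exact inverse [l], on either side. *)
have lim0 y z : (forall n, `|y| <= `|z| * `|u n - l| + 2^-1 ^+ n) -> y = 0.
  move=> h; apply: cstar_norm_eq0; apply/eqP; rewrite eq_le norm_ge0 andbT.
  apply/ler_addgt0Pl => e e0; rewrite addr0.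
  have z1 : 0 < `|z| + 1 by rewrite ltr_wpDl // norm_ge0.
  have [N hN] := @half_expr_lt (e / 2) ltac:(lra).
  move: hl => /cvgrPdist_lt/(_ (e / 2 / (`|z| + 1)))[|M _ hM].
    by rewrite divr_gt0 //; lra.
  have := hM (maxn N M) (leq_maxr _ _); have := hN (maxn N M) (leq_maxl _ _).
  have := h (maxn N M); rewrite /= sub0r normrN ger0_norm ?norm_ge0 //.
  move: (2^-1 ^+ _) (norm_ge0 (u (maxn N M) - l)) => t.
  move: (cstar_norm (u _ - l)) => v v0 h1 h2.
  by rewrite ltr_pdivlMr // => h3; nra.
exists l; split; apply/eqP; rewrite -subr_eq0; apply/eqP;
  apply: (lim0 _ (1 - x)) => n.
- have -> : l * (1 - x) - 1 = - ((u n - l) * (1 - x) + x ^+ n).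
    by rewrite mulrBl (expu n).2 addrAC subrK opprB.
  rewrite normN; apply: le_trans (cstar_norm_triangle _ _) _.
  by rewrite lerD ?xn // mulrC cstar_normM.
- have -> : (1 - x) * l - 1 = - ((1 - x) * (u n - l) + x ^+ n).
    by rewrite mulrBr (expu n).1 addrAC subrK opprB.
  rewrite normN; apply: le_trans (cstar_norm_triangle _ _) _.
  by rewrite lerD ?xn // cstar_normM.
Qed.

(** * Gelfand-Mazur in the corner of a projection *)

Lemma norm_normc_Re (s t : R) : Num.norm s <= Normc.normc (s +i* t)%C.
Proof. by rewrite /= -sqrtr_sqr ler_sqrt ?lerDl ?sqr_ge0 // addr_ge0 ?sqr_ge0. Qed.

Lemma norm_normc_Im (s t : R) : Num.norm t <= Normc.normc (s +i* t)%C.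
Proof. by rewrite /= -sqrtr_sqr ler_sqrt ?lerDr ?sqr_ge0 // addr_ge0 ?sqr_ge0. Qed.

Lemma normc_real (s : R) : Normc.normc (s%:C%C) = Num.norm s.
Proof. by rewrite /= expr0n /= addr0 sqrtr_sqr. Qed.

Lemma normc_le (s t : R) : Normc.normc (s +i* t)%C <= Num.norm s + Num.norm t.
Proof.
rewrite -[leRHS]ger0_norm ?addr_ge0 // -sqrtr_sqr /= ler_sqrt ?sqr_ge0 //.
by rewrite sqrrD !real_normK ?num_real // addrAC lerDl mulrn_wge0 // mulr_ge0.
Qed.

Lemma normc_ge0 (c : R[i]) : 0 <= Normc.normc c.
Proof. by case: c => ? ?; rewrite sqrtr_ge0. Qed.

Section Corner.
Variable p : A.
Hypotheses (ppp : p * p = p) (sp : p^† = p) (p0 : p != 0).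
Hypothesis corner_div : forall y, p * y * p = y -> y != 0 ->
  exists w, [/\ p * w * p = w, w * y = p & y * w = p].

Lemma norm_proj : `|p| = 1.
Proof.
have n1 : `|p| != 0 by rewrite gt_eqF // norm_gt0.
have := cstar_normE p; rewrite sp ppp expr2.
by move=> /esym h; apply: (mulfI n1); rewrite h mulr1.
Qed.

(** [r] is the resolvent of [y] in the corner with unit [p], supposed to exist at every complex
    number; [corner_selfadj_scalar] draws the contradiction. *)
Section Resolvent.
Variables (y : A) (r : R[i] -> A).
Hypothesis sy : y^† = y.
Hypothesis rP : forall c,
  [/\ p * r c * p = r c, r c * (y - c *: p) = p & (y - c *: p) * r c = p].

Let nc := @Normc.normc R.
Let n c := (`|r c|)^-1.

Let prp c : p * r c * p = r c. Proof. by case: (rP c). Qed.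
Let rp c : r c * p = r c. Proof. by rewrite -prp -mulrA ppp. Qed.
Let pr c : p * r c = r c. Proof. by rewrite -prp !mulrA ppp. Qed.

Lemma resolvent_identity c d : r c - r d = (c - d) *: (r d * r c).
Proof.
have [_ _ hc] := rP c; have [_ hd _] := rP d.
have : r d * (y - d *: p) * r c - r d * ((y - c *: p) * r c) = r c - r d.
  by rewrite hd hc pr rp.
move=> <-; rewrite [r d * (_ * _)]mulrA -mulrBl -mulrBr.
have -> : y - d *: p - (y - c *: p) = (c - d) *: p.
  by rewrite opprB addrAC [y + _]addrC subrK scalerBl.
by rewrite -scalerAr -scalerAl rp.
Qed.

Lemma resolvent_comm c d : r c * r d = r d * r c.
Proof.
have [->//|cd] := eqVneq c d.
have : (d - c) *: (r c * r d) = (d - c) *: (r d * r c).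
  by rewrite -resolvent_identity -opprB resolvent_identity -scaleNr opprB.
by apply: scalerI; rewrite subr_eq0 eq_sym.
Qed.

Lemma resolvent_star c : (r c)^† = r c^*.
Proof.
have [_ /(congr1 star) + _] := rP c; rewrite starM starB star_scale sp sy => e.
have rsp : p * (r c)^† = (r c)^† by rewrite -{2}rp starM sp.
have [_ h _] := rP c^*.
by rewrite -rsp -[p in LHS]h -mulrA e rp.
Qed.

Lemma resolvent_gt0 c : 0 < `|r c|.
Proof.
apply: norm_gt0; apply: contra p0 => /eqP h.
by have [_ <- _] := rP c; rewrite h mul0r.
Qed.

(** Taking the reciprocal [n] of the resolvent norm turns the resolvent identity into a Lipschitz
    bound, hence continuity. *)
Lemma resolvent_lipschitz c d : n c <= n d + nc (c - d).
Proof.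
have gc := resolvent_gt0 c; have gd := resolvent_gt0 d.
have : `|r d| <= `|r c| + nc (c - d) * (`|r c| * `|r d|).
  have e : r d = r c - (c - d) *: (r d * r c).
    by rewrite -resolvent_identity opprB addrC subrK.
  rewrite {1}e; apply: le_trans (norm_triangleB _ _) _; rewrite lerD // cstar_normZ.
  by rewrite [`|r c| * _]mulrC /nc ler_wpM2l ?normc_ge0 // cstar_normM.
move=> h; rewrite /n -(ler_pM2r gc) -(ler_pM2r gd) mulVf ?gt_eqF // mul1r.
by rewrite !mulrDl [_ * _ * `|r d|]mulrAC mulVf ?gt_eqF // mul1r -mulrA.
Qed.

Lemma resolvent_decay c : nc c - `|y| <= n c.
Proof.
have gc := resolvent_gt0 c.
have : nc c * `|r c| <= `|r c| * `|y| + 1.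
  rewrite -cstar_normZ -norm_proj; have [_ h _] := rP c.
  have -> : c *: r c = r c * y - p.
    by rewrite -[X in _ - X]h mulrBr opprB addrC subrK -scalerAr rp.
  by apply: le_trans (norm_triangleB _ _) _; rewrite lerD // cstar_normM.
move=> h; rewrite /n -(ler_pM2r gc) mulVf ?gt_eqF // mulrBl [`|y| * _]mulrC.
by rewrite lerBlDl.
Qed.

Lemma resolvent_max : exists c, forall d, `|r d| <= `|r c|.
Proof.
suff [c hc] : exists c, forall d, n c <= n d.
  exists c => d; have := hc d; rewrite /n lef_pV2 // posrE; exact: resolvent_gt0.
(* Outside the square of radius [K], [resolvent_decay] gives [n 0 <= n c], so a minimum over this
   compact square is global. *)
pose K := `|y| + n 0.
have n0 c : 0 <= n c by rewrite invr_ge0 norm_ge0.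
have K0 : 0 <= K by rewrite addr_ge0 ?norm_ge0.
pose Q : set (R * R) := `[- K, K]%classic `*` `[- K, K]%classic.
pose f (z : R * R) := n (z.1 +i* z.2)%C.
have Q0 : Q (0, 0) by split=> /=; rewrite in_itv /= oppr_le0 K0.
have cQ : compact Q by apply: compact_setX; exact: segment_compact.
have cf : {within Q, continuous f}.
  apply: continuous_subspaceT => z; apply/cvgrPdist_lt => e e0.
  pose V t := [set s : R | Num.norm (t - s) < e / 2].
  have nV t : nbhs t (V t) by apply/nbhs_ballP; exists (e / 2) => //=; lra.
  exists (V z.1, V z.2); first by split; exact: nV.
  move=> [s t] [/= hs ht].
  have -> : e = e / 2 + e / 2 by lra.
  apply: le_lt_trans (ltrD hs ht); apply: le_trans (normc_le _ _).
  have -> : ((z.1 - s) +i* (z.2 - t))%C = (z.1 +i* z.2)%C - (s +i* t)%C by [].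
  rewrite ler_norml lerBlDl resolvent_lipschitz andbT lerNl opprB lerBlDl.
  by rewrite -(normcN (_ - _ : R[i])) opprB resolvent_lipschitz.
have [z Qz hz] := compact_EVT_min (ex_intro _ _ Q0) cQ cf.
exists (z.1 +i* z.2)%C => -[s t].
have [Qst|nQ] := pselect (Q (s, t)); first exact: (hz (s, t)) (mem_set Qst).
apply: le_trans (hz (0, 0) (mem_set Q0)) _; apply: le_trans (resolvent_decay _).
suff : K <= nc (s +i* t)%C by rewrite /K lerBrDl.
rewrite leNgt; apply/negP => h; apply: nQ; split => /=;
  rewrite in_itv /= -ler_norml.
  exact: le_trans (norm_normc_Re _ _) (ltW h).
exact: le_trans (norm_normc_Im _ _) (ltW h).
Qed.

(** [w] is a product of resolvents, cancelling the linear factors one by one. [horner_alg] sends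
    constants to multiples of 1, not of [p]; the rule [r c * p = r c] absorbs the difference. *)
Lemma resolvent_prod c (rs : seq R[i]) : exists w,
  [/\ w * p = w, w * horner_alg (y - c *: p) (\prod_(z <- rs) ('X - z%:P)) = p
    & `|w| <= \prod_(z <- rs) `|r (c + z)|].
Proof.
elim: rs => [|z rs [w [wp hw wle]]].
  by exists p; split; rewrite // big_nil ?rmorph1 ?mulr1 // norm_proj.
exists (w * r (c + z)); split; first by rewrite -mulrA rp.
- rewrite big_cons rmorphM rmorphB /= horner_algX horner_algC.
  rewrite mulrA -(mulrA w).
  have -> : r (c + z) * (y - c *: p - z%:A) = p.
    have [_ h _] := rP (c + z); rewrite -[RHS]h scalerDl opprD addrA.
    by rewrite ![r _ * (_ - _ - _)]mulrBr -!scalerAr mulr1 rp.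
  by rewrite wp.
- rewrite big_cons mulrC; apply: le_trans (cstar_normM _ _) _.
  by rewrite ler_wpM2r ?norm_ge0.
Qed.

(* The maximum principle without complex analysis: 'X^N - d^N splits into linear
   factors 'X - z, one of them 'X - d, and the product of the resolvents at c + z
   inverts (y - c)^N - d^N; the powers of the normal element r c have the norm of
   a power when N = 2 ^ k. *)
Lemma resolvent_max_principle c d : (forall d, `|r d| <= `|r c|) ->
  nc d * `|r c| <= 2^-1 -> `|r (c + d)| = `|r c|.
Proof.
move=> cmax dle; apply/eqP; rewrite eq_le cmax /=.
set G := `|r c|; have G0 : 0 < G by exact: resolvent_gt0.
have main k : G <= `|r (c + d)| * (1 + 2^-1 ^+ (2 ^ k)).
  have n0 : (0 < 2 ^ k)%N by rewrite expn_gt0.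
  have nw : `|r c ^+ (2 ^ k)| = G ^+ (2 ^ k).
    by apply: norm_expr_normal; rewrite resolvent_star resolvent_comm.
  move: (2 ^ k)%N n0 nw => N N0 nw.
  pose x := y - c *: p.
  have [rs e] : exists rs, 'X^N - (d ^+ N)%:P = \prod_(z <- rs) ('X - z%:P).
    have [rs e] := closed_field_poly_normal ('X^N - (d ^+ N)%:P); exists rs.
    by rewrite {1}e (monicP (monicXnsubC _ N0)) scale1r.
  have srs : size rs = N.
    have := congr1 (fun q : {poly R[i]} => size q) e.
    by rewrite size_XnsubC // size_prod_XsubC => -[].
  have drs : d \in rs.
    by rewrite -root_prod_XsubC -e rootE !hornerE subrr.
  have [w [wp hw wle]] := resolvent_prod c rs.
  have prX m : p * r c ^+ m.+1 = r c ^+ m.+1 by rewrite exprS mulrA pr.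
  have xr : x ^+ N * r c ^+ N = p.
    have xp : x * r c = p by case: (rP c).
    rewrite -(prednK N0); elim: (N.-1) => [|m IH]; first by rewrite !expr1.
    rewrite [x ^+ _]exprSr [r c ^+ m.+2]exprS -mulrA [x * _]mulrA xp.
    by rewrite prX IH.
  (* Obtained by multiplying w (x^N - d^N) = p by [r c ^+ N] on the right. *)
  have e2 : r c ^+ N = w * (1 - d ^+ N *: r c ^+ N).
    rewrite mulrBr mulr1 -{1}wp -xr mulrA -scalerAr [_ *: _]scalerAl -mulrBl.
    have -> : w * x ^+ N - d ^+ N *: w = p.
      rewrite -[RHS]hw -e rmorphB rmorphXn /= horner_algX horner_algC mulrBr.
      by rewrite -scalerAr mulr1.
    by rewrite -(prednK N0) prX.
  have wle' : `|w| <= `|r (c + d)| * G ^+ N.-1.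
    apply: le_trans wle _.
    rewrite (perm_big _ (perm_to_rem drs)) big_cons ler_wpM2l ?norm_ge0 //=.
    rewrite -srs -(size_rem drs); elim: (rem d rs) => [|z s IH].
      by rewrite big_nil.
    by rewrite big_cons exprS ler_pM ?prodr_ge0 ?norm_ge0 // => i _;
      rewrite norm_ge0.
  have : G ^+ N <= `|w| * (1 + 2^-1 ^+ N).
    rewrite -nw {1}e2; apply: le_trans (cstar_normM _ _) _.
    rewrite ler_wpM2l ?norm_ge0 //; apply: le_trans (norm_triangleB _ _) _.
    rewrite norm1 lerD2l cstar_normZ nw.
    have -> : Normc.normc (d ^+ N) = nc d ^+ N.
      by elim: N {N0 nw e srs wle xr e2 wle'} => [|N IH];
        rewrite ?expr0 ?Normc.normc1 // !exprS Normc.normcM IH.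
    by rewrite -exprMn lerXn2r // nnegrE ?mulr_ge0 ?normc_ge0 ?norm_ge0 // invr_ge0.
  rewrite -{1}(prednK N0) exprS => h.
  have GN : 0 < G ^+ N.-1 by rewrite exprn_gt0.
  rewrite -(ler_pM2r GN) mulrAC; apply: le_trans h _.
  by rewrite ler_wpM2r // addr_ge0 // exprn_ge0 // invr_ge0.
(* The correction term of [main] tends to 0 as k grows, which excludes a strict inequality. *)
rewrite leNgt; apply/negP => lt.
have g0 := resolvent_gt0 (c + d).
have [|N hN] := @half_expr_lt ((G - `|r (c + d)|) / `|r (c + d)|).
  by rewrite divr_gt0 // subr_gt0.
have := hN (2 ^ N)%N (ltnW (ltn_expl N (ltnSn 1))).
rewrite ltr_pdivlMr // ltrBrDl => h; have := main N.
by rewrite mulrDr mulr1 [_ * 2^-1 ^+ _]mulrC leNgt h.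
Qed.

End Resolvent.

(** If y is no scalar, its resolvent exists everywhere and its norm has a maximum. The maximum
    principle carries this maximal value along a ray to infinity, against [resolvent_decay]. *)
Lemma corner_selfadj_scalar y : p * y * p = y -> y^† = y -> exists c, y = c *: p.
Proof.
move=> pyp sy; apply: contrapT => nex.
have /choice [r rP] : forall c, exists w,
    [/\ p * w * p = w, w * (y - c *: p) = p & (y - c *: p) * w = p].
  move=> c; apply: corner_div.
    by rewrite mulrBr mulrBl pyp -scalerAr -scalerAl !ppp.
  by apply: contra_notN nex => /eqP h; exists c; apply/eqP; rewrite -subr_eq0 h.
have [c cmax] := resolvent_max rP.
have G0 := resolvent_gt0 rP c.
(* The longest step that [resolvent_max_principle] allows; the norm stays maximal, so the same step
   can be repeated. *)
pose d : R[i] := (2^-1 / `|r c|)%:C%C.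
have nd : Normc.normc d = 2^-1 / `|r c|.
  by rewrite normc_real ger0_norm // divr_ge0 ?norm_ge0.
have all n : `|r (c + d *+ n)| = `|r c|.
  elim: n => [|n IH]; first by rewrite addr0.
  rewrite mulrSr addrA -[RHS]IH; apply: (resolvent_max_principle sy rP).
    by move=> z; rewrite IH.
  by rewrite IH nd divfK ?gt_eqF.
pose K := (`|r c|)^-1 + `|y| + Normc.normc c.
have t0 : 0 < Normc.normc d by rewrite nd divr_gt0.
have K0 : 0 <= K by rewrite !addr_ge0 ?normc_ge0 ?norm_ge0 // invr_ge0 norm_ge0.
have := archi_boundP (divr_ge0 K0 (ltW t0)).
set n := Num.Def.archi_bound _; rewrite ltr_pdivrMr // => hn.
have := resolvent_decay rP (c + d *+ n); rewrite all.
have : Normc.normc (d *+ n) <= Normc.normc (c + d *+ n) + Normc.normc c.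
  rewrite -{1}[d *+ n](addKr c) addrC -(normcN c); exact: le_normcD.
rewrite normcMn -mulr_natl; move: hn; rewrite /K.
move: (Normc.normc (c + _)) => u; lra.
Qed.

Lemma corner_scalar y : p * y * p = y -> exists c, y = c *: p.
Proof.
move=> pyp; have pysp : p * y^† * p = y^†.
  by rewrite -{2}pyp !starM sp mulrA.
have [c hc] : exists c, y + y^† = c *: p.
  apply: corner_selfadj_scalar; first by rewrite mulrDr mulrDl pyp pysp.
  by rewrite starD starK addrC.
have [d hd] : exists d, 'i%C *: (y - y^†) = d *: p.
  apply: corner_selfadj_scalar.
    by rewrite -scalerAr -scalerAl mulrBr mulrBl pyp pysp.
  rewrite star_scale starB starK -opprB scalerN -scaleNr; congr (_ *: _).
  by simpc.
exists (2^-1 * (c - 'i%C * d)).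
have e : y - y^† = - ('i%C * d) *: p.
  rewrite scaleNr -scalerA -hd scalerA -expr2 sqr_i scaleN1r opprK //.
have : y *+ 2 = (c - 'i%C * d) *: p.
  by rewrite scalerDl -hc -e addrACA subrr addr0 mulr2n.
rewrite -scaler_nat -scalerA => <-.
by rewrite scalerA mulVf ?scale1r // pnatr_eq0.
Qed.

End Corner.

(** * Minimal projections and rank-one elements *)

(** Minimality is encoded by a one-dimensional corner, not by the absence of smaller projections. *)
Definition minimal_projection p :=
  [/\ p * p = p, p^† = p, p != 0 & forall a, exists c, p * a * p = c *: p].

(** Brauer's argument with the self-adjoint element a = x* x of L, whose square is nonzero: right
    multiplication by a is bijective on L, the preimage e of a is an idempotent right unit of L, and
    e A e is a division algebra, so [corner_scalar] applies. *)
Lemma minimal_left_ideal_projection (L : set A) : minimal_left_ideal L ->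
  exists p, minimal_projection p /\ forall x, L x -> x * p = x.
Proof.
move=> [[L0 LD LM] [x Lx x0] Lmin].
have LB y z : L y -> L z -> L (y - z) by move=> Ly Lz; rewrite -mulN1r;
  apply: LD => //; exact: LM.
have lmul u z : L u -> L z -> z * u != 0 -> forall v, L v ->
  exists2 w, L w & w * u = v.
  move=> Lu Lz zu0 v Lv.
  have e : [set w * u | w in L] = L.
    apply: Lmin.
    - split; first by exists 0; rewrite ?mul0r.
        by move=> _ _ [a La <-] [b Lb <-]; exists (a + b); rewrite ?mulrDl //;
          exact: LD.
      by move=> a _ [b Lb <-]; exists (a * b); rewrite ?mulrA //; exact: LM.
    - by exists (z * u) => //; exists z.
    - by move=> _ [a La <-]; exact: LM.
  by move: Lv; rewrite -{1}e => -[w Lw wv]; exists w.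
have rann u z : L u -> L z -> u != 0 -> z * u != 0 -> forall w, L w ->
  w * u = 0 -> w = 0.
  move=> Lu Lz u0 zu0 w Lw wu; apply/eqP; apply: contraT => w0.
  have e : [set v | L v /\ v * u = 0] = L.
    apply: Lmin.
    - split; first by split; rewrite ?mul0r.
        by move=> a b [La ha] [Lb hb]; split;
          [exact: LD | rewrite mulrDl ha hb addr0].
      by move=> a b [Lb hb]; split; [exact: LM | rewrite -mulrA hb mulr0].
    - by exists w.
    - by move=> v [].
  by move: Lz; rewrite -e => -[_ h]; rewrite h eqxx in zu0.
pose a := x^† * x.
have La : L a by exact: LM.
have sa : a^† = a by rewrite /a starM starK.
have a0 : a != 0 by apply: contra x0 => /eqP/star_mul_eq0 ->.
have aa0 : a * a != 0 by rewrite -{1}sa; apply: contra a0 => /eqP/star_mul_eq0 ->.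
have [e Le ea] := lmul _ _ La La aa0 _ La.
have ra := rann _ _ La La a0 aa0.
have ee : e * e = e.
  by apply/eqP; rewrite -subr_eq0; apply/eqP/ra; [exact/LB/Le/LM
    | rewrite mulrBl -mulrA !ea subrr].
have e0 : e != 0 by apply: contra a0 => /eqP e0; rewrite -ea e0 mul0r.
have ee0 : e * e != 0 by rewrite ee.
have re := rann _ _ Le Le e0 ee0.
have Lr w : L w -> w * e = w.
  move=> Lw; apply/eqP; rewrite -subr_eq0; apply/eqP/re; first exact/LB/Lw/LM.
  by rewrite mulrBl -mulrA ee subrr.
have einv u : e * u * e = u -> u != 0 ->
  exists w, [/\ e * w * e = w, w * u = e & u * w = e].
  have linv v : e * v * e = v -> v != 0 ->
    exists w, [/\ e * w * e = w, w != 0 & w * v = e].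
    move=> ev v0; have Lv : L v by rewrite -ev; exact: LM.
    have [|w Lw wv] := lmul v e Lv Le _ e Le; first by rewrite -{1}ev !mulrA ee ev.
    exists (e * w); split; last by rewrite -mulrA wv.
    - by rewrite -!mulrA Lr // mulrA ee.
    - by apply: contra e0 => /eqP h; rewrite -ee -{2}wv mulrA h mul0r.
  move=> eu u0; have [w [ew w0 wu]] := linv u eu u0.
  have [w' [ew' _ w'w]] := linv w ew w0; exists w; split=> //.
  have Lw' : L w' by rewrite -ew'; exact: LM.
  suff -> : u = w' by [].
  by rewrite -(Lr w') // -wu mulrA w'w -eu !mulrA ee.
(* With b the inverse of a in the corner, e* = a b*; as e a = a, this gives e e* = e*, and e e* is
   self-adjoint. *)
have se : e^† = e.
  have [b [_ ba ab]] : exists w, [/\ e * w * e = w, w * a = e & a * w = e].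
    by apply: einv; rewrite ?ea ?Lr.
  have : e^† = a * b^† by rewrite -ba starM sa.
  move=> h; have : e * e^† = e^† by rewrite h mulrA ea.
  by move=> h'; have := congr1 star h'; rewrite starM starK h'.
exists e; split => //; split => // y.
by apply: corner_scalar => //; rewrite !mulrA ee -!mulrA ee.
Qed.

(** Otherwise v kills the socle from the left. The left annihilator of the socle is then a nonzero
    two-sided ideal, and an x both in it and in the socle satisfies x x* x = 0. *)
Lemma essential_socle_projection v : has_essential_socle A -> v != 0 ->
  exists p z, minimal_projection p /\ v * z * p != 0.
Proof.
move=> [[[S0 SD SM] SR] _ ess] v0; apply: contrapT => nex.
have vS x : socle x -> v * x = 0.
  move=> [s hs ->]; rewrite mulr_sumr big_seq big1 // => y /hs[L Lmin Ly].
  have [p [pmin Lp]] := minimal_left_ideal_projection Lmin.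
  apply/eqP; apply: contra_notT nex => vy0; exists p, y.
  by rewrite -mulrA Lp.
have [||x [Sx Jx] x0] := ess [set a | forall x, socle x -> a * x = 0].
- split; first split.
  + by move=> x _; rewrite mul0r.
  + by move=> a b ha hb x Sx; rewrite mulrDl ha ?hb ?addr0.
  + by move=> a b hb x Sx; rewrite -mulrA hb ?mulr0.
  + by move=> a b ha x Sx; rewrite -mulrA ha //; exact: SM.
- by exists v.
- move/eqP: x0; apply; apply: mul_star_mul_eq0; rewrite -mulrA.
  by apply: Jx; exact: SM.
Qed.

Lemma starZR (t : R) x : (t%:C%C *: x)^† = t%:C%C *: x^†.
Proof. by rewrite star_scale; congr (_ *: _); exact: conjc_real. Qed.

(* If z* z = k p with k < 0, the Hermitian form w* w on the span of z and p is
   indefinite, so it has a nonzero isotropic vector z - t p. *)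
Lemma minimal_projection_ge0 p z : minimal_projection p -> z * p = z ->
  exists2 k : R, 0 <= k & z^† * z = k%:C%C *: p.
Proof.
move=> [pp sp p0 pAp] zp.
have scp c d : c *: p = d *: p -> c = d.
  by move/eqP; rewrite -subr_eq0 -scalerBl scaler_eq0 (negPf p0) orbF subr_eq0 =>
    /eqP.
have pz : p * z^† = z^† by rewrite -{2}zp starM sp.
have [c hc] := pAp (z^† * z); rewrite mulrA pz -mulrA zp in hc.
have [b hb] := pAp z; rewrite -mulrA zp in hb.
have cR : c = (complex.Re c)%:C%C.
  have : c^* = c by apply: scp; rewrite -hc -{1}sp -star_scale -hc starM starK.
  case: c {hc} => s t [] h; congr (_ +i* _)%C; lra.
exists (complex.Re c); last by rewrite -cR.
rewrite leNgt; apply/negP; set k := complex.Re c in cR * => k0.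
have kz t : z = - (t%:C%C *: p) -> False.
  move=> e; suff : k = t ^+ 2 by move=> h; move: k0; rewrite h ltNge sqr_ge0.
  have : k%:C%C = (t ^+ 2)%:C%C.
    apply: scp; rewrite -cR -hc e starN starZR sp mulNr mulrN opprK.
    by rewrite -scalerAl -scalerAr pp scalerA -rmorphM expr2.
  by case.
(* [t] is a root of t^2 - 2 s t + k, real because k < 0; this polynomial is the coefficient of (z -
   t p)* (z - t p) along p. *)
pose s := complex.Re b; pose t := s + Num.sqrt (s ^+ 2 - k).
apply: (kz (- t)); rewrite rmorphN scaleNr opprK; apply/eqP; rewrite -subr_eq0;
  apply/eqP.
apply: star_mul_eq0; rewrite starB starZR sp mulrBl !mulrBr hc.
rewrite -!scalerAr -!scalerAl pp hb.
have -> : z^† * p = b^* *: p by rewrite -sp -starM hb star_scale.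
rewrite !scalerA -!scalerBl -[RHS](scale0r p); congr (_ *: _).
rewrite cR.
have -> : b = (s +i* complex.Im b)%C by rewrite /s; case: (b).
rewrite /t; move: (complex.Im b) => m.
have h : 0 <= s ^+ 2 - k by rewrite subr_ge0 (le_trans (ltW k0)) ?sqr_ge0.
have := sqr_sqrtr h; move: (Num.sqrt _) => q hq.
have -> : k = s ^+ 2 - q ^+ 2 by rewrite hq opprB addrC subrK.
apply/eqP; rewrite eq_complex /=; apply/andP; split; apply/eqP; ring.
Qed.

Definition rank_one u := u != 0 /\ forall a, exists c, u * a * u = c *: u.

Lemma rank_oneZ c u : c != 0 -> rank_one u -> rank_one (c *: u).
Proof.
move=> c0 [u0 ru]; split=> [|a]; first by rewrite scaler_eq0 negb_or c0.
have [d hd] := ru a; exists (d * c).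
by rewrite -!scalerAl -scalerAr hd !scalerA; congr (_ *: _); ring.
Qed.

Lemma rank_oneMl u x : rank_one u -> x * u != 0 -> rank_one (x * u).
Proof.
move=> [u0 ru] xu0; split=> // a; have [c hc] := ru (a * x).
by exists c; rewrite scalerAr -hc !mulrA.
Qed.

Lemma rank_oneMr u x : rank_one u -> u * x != 0 -> rank_one (u * x).
Proof.
move=> [u0 ru] xu0; split=> // a; have [c hc] := ru (x * a).
by exists c; rewrite scalerAl -hc !mulrA.
Qed.

(** Let u x x* u* u = c u. If c = 0, then (u x)(u x)* (u x) = 0; otherwise multiplying by y on the
    left kills y u. *)
Lemma rank_oneMM u x y : rank_one u -> y * u * x = 0 -> y * u = 0 \/ u * x = 0.
Proof.
move=> [u0 ru] yux; have [c hc] := ru (x * x^† * u^†).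
have [c0|c0] := eqVneq c 0; [right | left].
  apply: mul_star_mul_eq0.
  by rewrite starM -[LHS](mulr1 _) -(mul0r x) -(scale0r u) -c0 -hc !mulrA mulr1.
have : c *: (y * u) = 0 by rewrite scalerAr -hc !mulrA yux !mul0r.
by move/eqP; rewrite scaler_eq0 (negPf c0) => /eqP.
Qed.

(** [N] is the squared norm of u; it is real because u u* u u* = N u u* is self-adjoint. *)
Lemma rank_one_norm u : rank_one u ->
  exists N, [/\ N != 0, N^* = N & u * u^† * u = N *: u].
Proof.
move=> [u0 ru]; have [N hN] := ru u^†; exists N; split=> //.
  by apply: contra u0 => /eqP N0; apply/eqP/mul_star_mul_eq0; rewrite hN N0 scale0r.
have : (N^* - N) *: (u * u^†) = 0.
  rewrite scalerBl scalerAr -star_scale -hN !starM starK scalerAl -hN !mulrA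
    subrr //.
move/eqP; rewrite scaler_eq0 subr_eq0 => /orP[/eqP//|/eqP /mul_star_eq0].
by move/eqP; rewrite (negPf u0).
Qed.

Lemma rank_one_sym u v : rank_one v -> u * v^† * u = 0 -> v * u^† * v = 0.
Proof.
move=> [v0 rv] uvu; have [c hc] := rv u^†.
have [c0|c0] := eqVneq c 0; first by rewrite hc c0 scale0r.
suff : v * u^† = 0 by move=> ->; rewrite mul0r.
apply/eqP; rewrite -star_eq0 starM starK; apply/eqP.
have : c^* *: (u * v^†) = 0.
  by rewrite scalerAr -star_scale -hc !starM starK !mulrA uvu mul0r.
by move/eqP; rewrite scaler_eq0 conjC_eq0 (negPf c0) => /eqP.
Qed.

Lemma diamond_leP a b : diamond_le a b <->
  [/\ exists x, a = b * x, exists x, a = x * b & a * a^† * a = a * b^† * a].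
Proof.
split=> -[h1 h2 h3]; split=> //.
- by have [|x _ <-] := h1 a; [exists 1; rewrite ?mulr1 | exists x].
- by have [|x _ <-] := h2 a; [exists 1; rewrite ?mul1r | exists x].
- by case: h1 => x -> _ [y _ <-]; exists (x * y); rewrite ?mulrA.
- by case: h2 => x -> _ [y _ <-]; exists (y * x); rewrite ?mulrA.
Qed.

(** The two inclusions put N^2 a = u u* a u* u in u A u, so a = c u; the remaining equation forces c
    = 0 or c = 1. *)
Lemma rank_one_minimal u a : rank_one u -> diamond_le a u -> a = 0 \/ a = u.
Proof.
move=> ru /diamond_leP[[x ax] [y ay] aua].
have [N [N0 NR uuu]] := rank_one_norm ru.
have [d hd] := ru.2 (u^† * a * u^†).
have Na : (N * N) *: a = d *: u.
  have uua : u * u^† * a = N *: a by rewrite ax mulrA uuu scalerAl.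
  have auu : a * u^† * u = N *: a by rewrite ay scalerAr -uuu !mulrA.
  by rewrite -hd !mulrA uua -!scalerAl auu scalerA.
have {x ax y ay hd Na} [c ac] : exists c, a = c *: u.
  exists ((N * N)^-1 * d); rewrite -scalerA -Na scalerA mulVf ?scale1r //.
  by rewrite mulf_neq0.
have [c0|c0] := eqVneq c 0; [by left; rewrite ac c0 scale0r | right].
move: aua; rewrite ac star_scale -!scalerAl -!scalerAr -!scalerAl uuu !scalerA =>
  /eqP; rewrite -subr_eq0 -scalerBl scaler_eq0 (negPf ru.1) orbF.
rewrite (_ : _ - _ = c * c * N * (c^* - 1)); last by ring.
rewrite !mulf_eq0 (negPf c0) (negPf N0) /= subr_eq0 => /eqP h.
by rewrite -[c](conjCK c) h rmorph1 scale1r.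
Qed.

(* The witness is u = m^-1 (v y) y*, where y = v* z p and y* y = m p. *)
Lemma exists_rank_one_le v : has_essential_socle A -> v != 0 ->
  exists2 u, rank_one u & diamond_le u v.
Proof.
rewrite -star_eq0 => ess v0.
have [p [z [pmin vzp0]]] := essential_socle_projection ess v0.
have [pp sp p0 pAp] := pmin.
have [y ydef] : exists y, y = v^† * z * p by exists (v^† * z * p).
have yp : y * p = y by rewrite ydef -mulrA pp.
rewrite -ydef in vzp0.
have [x xdef] : exists x, x = v * y by exists (v * y).
have py : p * y^† = y^† by rewrite -{2}yp starM sp.
have [m hm] := pAp (y^† * y); rewrite mulrA py -mulrA yp in hm.
have m0 : m != 0.
  by apply: contra vzp0 => /eqP m0; apply/eqP/star_mul_eq0; rewrite hm m0 scale0r.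
have mR : m^* = m.
  have /eqP : (m^* - m) *: p = 0.
    by rewrite scalerBl -hm -{1}sp -star_scale -hm starM starK subrr.
  by rewrite scaler_eq0 (negPf p0) orbF subr_eq0 => /eqP.
have xp : x * p = x by rewrite xdef -mulrA yp.
have px : p * x^† = x^† by rewrite -{2}xp starM sp.
have x0 : x != 0.
  apply: contra vzp0 => /eqP x0; apply/eqP/star_mul_eq0.
  by rewrite {1}ydef !starM starK -!mulrA -xdef x0 !mulr0.
have ru0 : rank_one (x * y^†).
  split.
    apply: contra x0 => /eqP h; have /eqP : m *: x = 0.
      by rewrite -xp scalerAr -hm mulrA h mul0r.
    by rewrite scaler_eq0 (negPf m0).
  move=> a; have [c hc] := pAp (y^† * a * x); exists c.
  have {}hc : y^† * a * x = c *: p by rewrite -hc !mulrA py -(mulrA _ x) xp.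
  have -> : x * y^† * a * (x * y^†) = x * (y^† * a * x) * y^† by rewrite !mulrA.
  by rewrite hc -scalerAr xp scalerAl.
exists (m^-1 *: (x * y^†)); first by apply: rank_oneZ; rewrite ?invr_eq0.
apply/diamond_leP; split.
- by exists (m^-1 *: (y * y^†)); rewrite -scalerAr mulrA xdef.
- exists (m^-1 *: (x * (z * p)^†)); rewrite -scalerAl -mulrA; congr (_ *: (_ * _)).
  by rewrite ydef -(mulrA v^†) starM starK.
- have mi : (m^-1)^* = m^-1 by rewrite fmorphV; congr (_^-1).
  rewrite star_scale mi starM starK -!scalerAl -!scalerAr -!scalerAl.
  have -> : x * y^† * (y * x^†) * (x * y^†) = m *: (x * x^† * x * y^†).
    have -> : x * y^† * (y * x^†) * (x * y^†) = x * (y^† * y) * x^† * x * y^†.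
      by rewrite !mulrA.
    by rewrite hm -scalerAr xp -!scalerAl.
  have -> : x * y^† * v^† * (x * y^†) = x * x^† * x * y^†.
    by rewrite -(mulrA x y^†) -starM -xdef !mulrA.
  by congr (_ *: (_ *: _)); rewrite scalerA mulVf ?scale1r.
Qed.

Lemma rank_oneP u : has_essential_socle A ->
  rank_one u <-> u != 0 /\ forall a, diamond_le a u -> a = 0 \/ a = u.
Proof.
move=> ess; split=> [ru|[u0 umin]].
  by split; [exact: ru.1 | move=> a; exact: rank_one_minimal].
have [v rv /umin[v0|<-//]] := exists_rank_one_le ess u0.
by move: rv.1; rewrite v0 eqxx.
Qed.

Lemma rank_one_separating v : has_essential_socle A ->
  (forall u, rank_one u -> u * v^† * u = 0) -> v = 0.
Proof.
move=> ess h; apply/eqP; apply: contraT => v0.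
have [u ru /diamond_leP[_ _ e]] := exists_rank_one_le ess v0.
by move: ru.1; rewrite (mul_star_mul_eq0 (etrans e (h u ru))) eqxx.
Qed.

(** Expanding (u + v) u* (u + v) = k (u + v) leaves N u + v u* u + u u* v. The product of v u* u and
    u* v vanishes, so by [rank_oneMM] one of the two cross terms is zero, and comparison gives k =
    N. *)
Lemma rank_one_adjacent u v N : rank_one u -> rank_one v -> rank_one (u + v) ->
  u * u^† * u = N *: u -> N != 0 -> u * v^† * u = 0 ->
  (u * u^† * v = N *: v /\ v * u^† = 0) \/ (v * u^† * u = N *: v /\ u^† * v = 0).
Proof.
move=> ru rv [_ ruv] uuu N0 uvu; have vuv := rank_one_sym rv uvu.
have [k hk] := ruv u^†.
have e : N *: u + v * u^† * u + u * u^† * v = k *: (u + v).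
  by rewrite -hk !mulrDl !mulrDr uuu vuv addr0 addrAC.
have /(rank_oneMM ru)[vuu|uuv] : (v * u^†) * u * (u^† * v) = 0.
- have -> : v * u^† * u * (u^† * v) = v * (u * u^† * u)^† * v.
    by rewrite !starM starK !mulrA.
  by rewrite uuu star_scale -scalerAr -scalerAl vuv scaler0.
- left; have vu : v * u^† = 0.
    by apply: mul_star_eq0; rewrite starM starK mulrA vuu mul0r.
  split=> //; have := congr1 (fun w => w * u^†) e.
  rewrite vuu addr0 mulrDl -[_ * v * _]mulrA vu mulr0 addr0 -!scalerAl mulrDl vu
    addr0.
  have uu0 : u * u^† != 0 by apply: contra ru.1 => /eqP/mul_star_eq0 ->.
  move=> /eqP; rewrite -subr_eq0 -scalerBl scaler_eq0 (negPf uu0) orbF subr_eq0.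
  by move=> /eqP Nk; move: e; rewrite vuu addr0 -Nk scalerDr => /addrI.
- right; have uv : u^† * v = 0.
    by apply: star_mul_eq0; rewrite starM starK -mulrA uuv mulr0.
  split=> //; have := congr1 (fun w => u^† * w) e.
  rewrite -[u * u^† * v]mulrA uv mulr0 addr0 mulrDr -!scalerAr mulrDr !mulrA uv.
  rewrite !mul0r !addr0.
  have uu0 : u^† * u != 0 by apply: contra ru.1 => /eqP/star_mul_eq0 ->.
  move=> /eqP; rewrite -subr_eq0 -scalerBl scaler_eq0 (negPf uu0) orbF subr_eq0.
  move=> /eqP Nk; move: e; rewrite -[u * u^† * v]mulrA uv mulr0 addr0 -Nk scalerDr.
  exact: addrI.
Qed.

(** * Peirce decomposition and the Jordan triple product *)

Lemma rank_one_coef u v c d : u * v^† != 0 ->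
  u * v^† * u = c *: u -> v * u^† * v = d *: v -> c = d^*.
Proof.
move=> uv0 hc hd; apply/eqP; rewrite -subr_eq0.
have /eqP : (c - d^*) *: (u * v^†) = 0.
  rewrite scalerBl scalerAl -hc scalerAr -star_scale -hd !starM starK !mulrA.
  by rewrite subrr.
by rewrite scaler_eq0 (negPf uv0) orbF.
Qed.

(* For u of rank one with u u* u = N u: the elements of e A (1 - f) or of
   (1 - e) A f, where e = N^-1 u u* and f = N^-1 u* u; [peirce0] is
   (1 - e) A (1 - f). *)
Definition peirce1 (N : R[i]) u v :=
  (u * u^† * v = N *: v /\ v * u^† = 0) \/ (v * u^† * u = N *: v /\ u^† * v = 0).

Definition peirce0 u v := u^† * v = 0 /\ v * u^† = 0.

Lemma peirce1Z c N u v : peirce1 N u v -> peirce1 N u (c *: v).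
Proof.
case=> -[h1 h2]; [left|right]; split.
- by rewrite -scalerAr h1 !scalerA mulrC.
- by rewrite -scalerAl h2 scaler0.
- by rewrite -!scalerAl h1 !scalerA mulrC.
- by rewrite -scalerAr h2 scaler0.
Qed.

(** Converse of [rank_one_adjacent]: v and u + v are both multiples of u on the same side. *)
Lemma peirce1_rank_one N u v : rank_one u -> u * u^† * u = N *: u -> N != 0 ->
  peirce1 N u v -> v != 0 -> [/\ rank_one v, rank_one (u + v) & u * v^† * u = 0].
Proof.
move=> ru uuu N0 h v0.
have uv0 : u + v != 0.
  apply: contra ru.1; rewrite addr_eq0 => /eqP uv; apply/eqP.
  case: h => -[_ h].
    by apply: mul_star_eq0; rewrite {1}uv mulNr h oppr0.
  by apply: star_mul_eq0; rewrite {2}uv mulrN h oppr0.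
case: h => -[h1 h2].
- have e : v = u * (N^-1 *: (u^† * v)).
    by rewrite -scalerAr mulrA h1 scalerA mulVf // scale1r.
  split; first by rewrite e; apply: rank_oneMr; rewrite -?e.
  + have -> : u + v = u * (1 + N^-1 *: (u^† * v)) by rewrite mulrDr mulr1 -e.
    by apply: rank_oneMr; rewrite // mulrDr mulr1 -e.
  + by rewrite -[u * _]starK starM starK h2 star0 mul0r.
- have e : v = (N^-1 *: (v * u^†)) * u.
    by rewrite -scalerAl h1 scalerA mulVf // scale1r.
  split; first by rewrite e; apply: rank_oneMl; rewrite -?e.
  + have -> : u + v = (1 + N^-1 *: (v * u^†)) * u by rewrite mulrDl mul1r -e.
    by apply: rank_oneMl; rewrite // mulrDl mul1r -e.
  + by rewrite -mulrA -[_ * u]starK starM starK h2 star0 mulr0.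
Qed.

(** With e and f as for [peirce1], the terms are e v f, e v (1 - f), (1 - e) v f and (1 - e) v (1 -
    f). Two terms are of type [peirce1], which is a union of two subspaces. *)
Lemma peirce_decomposition N u v : rank_one u -> u * u^† * u = N *: u ->
  N != 0 -> N^* = N -> exists c v1 v1' v0,
    [/\ v = c *: u + v1 + v1' + v0, peirce1 N u v1, peirce1 N u v1' & peirce0 u v0].
Proof.
move=> ru uuu N0 NR; have [d hd] := ru.2 (u^† * v * u^†).
have suu : u^† * u * u^† = N *: u^†
  by rewrite -NR -star_scale -uuu !starM starK mulrA.
pose v2 := (N^-1 * N^-1 * d) *: u.
have v2E : v2 = (N^-1 * N^-1) *: (u * u^† * v * u^† * u).
  by rewrite /v2 -scalerA -hd !mulrA.
pose v1 := N^-1 *: (u * u^† * v) - v2; pose v1' := N^-1 *: (v * u^† * u) - v2.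
have sv1 : u^† * (v2 + v1) = u^† * v.
  rewrite addrC subrK -scalerAr !mulrA suu -scalerAl scalerA mulVf //.
  by rewrite scale1r.
have sv1' : (v2 + v1') * u^† = v * u^†.
  rewrite addrC subrK -scalerAl -!mulrA (mulrA u^†) suu -scalerAr scalerA.
  by rewrite mulVf // scale1r.
have v1u : v1 * u^† = 0.
  rewrite mulrBl v2E -!scalerAl -[_ * u * u^†]mulrA -[_ * u^† * (u * _)]mulrA.
  rewrite [u^† * (u * _)]mulrA suu -!scalerAr scalerA mulfVK //.
  by rewrite subrr.
have uv1' : u^† * v1' = 0.
  rewrite mulrBr v2E -!scalerAr !mulrA suu -!scalerAl scalerA mulfVK //.
  by rewrite subrr.
exists (N^-1 * N^-1 * d), v1, v1', (v - (v2 + v1 + v1')); split.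
- by rewrite -/v2 addrC subrK.
- left; split=> //; apply: (addrI (u * u^† * v2)).
  rewrite -mulrDr -(mulrA u _ (v2 + v1)) sv1 mulrA.
  have -> : u * u^† * v2 = N *: v2 by rewrite -scalerAr uuu scalerA mulrC -scalerA.
  by rewrite -scalerDr addrC subrK scalerA mulfV // scale1r.
- right; split=> //; apply: (addrI (v2 * u^† * u)).
  rewrite -!mulrDl sv1'.
  have -> : v2 * u^† * u = N *: v2.
    by rewrite /v2 -!scalerAl uuu !scalerA; congr (_ *: _); exact: mulrC.
  by rewrite -scalerDr addrC subrK scalerA mulfV // scale1r.
- split; first by rewrite mulrBr mulrDr sv1 uv1' addr0 subrr.
  by rewrite [v2 + v1]addrC -addrA mulrBl mulrDl v1u add0r sv1' subrr.
Qed.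

(** The Jordan triple product without the customary factor 1/2. *)
Definition triple x y z := x * y^† * z + z * y^† * x.

Lemma tripleC x y z : triple x y z = triple z y x.
Proof. by rewrite /triple addrC. Qed.

Lemma tripleDl x x' y z : triple (x + x') y z = triple x y z + triple x' y z.
Proof. by rewrite /triple !mulrDl mulrDr addrACA. Qed.

Lemma tripleZl c x y z : triple (c *: x) y z = c *: triple x y z.
Proof. by rewrite /triple -!scalerAl -scalerAr scalerDr. Qed.

Lemma tripleDm x y y' z : triple x (y + y') z = triple x y z + triple x y' z.
Proof. by rewrite /triple starD !mulrDr !mulrDl addrACA. Qed.

Lemma tripleZm c x y z : triple x (c *: y) z = c^* *: triple x y z.
Proof. by rewrite /triple star_scale -!scalerAr -!scalerAl scalerDr. Qed.

Lemma triple_peirce1 N u v : peirce1 N u v -> triple u u v = N *: v.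
Proof.
rewrite /triple => -[] [h1 h2]; rewrite h1.
  by rewrite h2 mul0r addr0.
by rewrite -mulrA h2 mulr0 add0r.
Qed.

Lemma triple_peirce0 u v x : peirce0 u v -> triple u v x = 0 /\ triple u u v = 0.
Proof.
rewrite /triple => -[uv vu]; split; last by rewrite vu -mulrA uv mulr0 mul0r addr0.
have -> : u * v^† = 0 by rewrite -[u]starK -starM vu star0.
by rewrite -mulrA -[u]starK -!starM uv star0 mulr0 mul0r addr0.
Qed.

(** For u of rank one, u x* u is a multiple of u, so each outer triple on the right has a multiple
    of u as an outer argument. *)
Lemma triple_quadratic u x y z :
  u * (triple x y z)^† * u = triple u x (triple y z u) - triple (u * x^† * u) z y.
Proof.
rewrite /triple starD !starM starK !(mulrDr, mulrDl) !mulrA.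
by rewrite [X in X - _](AC (2*2) ((1*4)*(2*3)))/= addrK addrC.
Qed.

Lemma invertible_near1 y : exists2 e : R, 0 < e &
  forall t, 0 <= t <= e -> invertible (1 + t%:C%C *: y).
Proof.
have y1 : 0 < cstar_norm y + 1 by rewrite ltr_wpDl // norm_ge0.
exists (2^-1 / (cstar_norm y + 1)); first by rewrite divr_gt0.
move=> t /andP[t0 te]; rewrite -[t%:C%C *: y]opprK; apply: neumann.
rewrite normN cstar_normZ normc_real ger0_norm //.
move: te; rewrite ler_pdivlMr // => te.
by apply: le_trans te; rewrite ler_wpM2l // lerDl.
Qed.

End CStarBasics.

(** * Prime rings *)

Section PrimeRings.
Variable B : nzRingType.
Hypothesis primeB : prime_ring B.
Implicit Types x y s t : B.

Lemma prime_ring_mul x y : (forall s, x * s * y = 0) -> x = 0 \/ y = 0.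
Proof.
(* [I] contains x, its right annihilator [J] contains y, and both are two-sided ideals. *)
move=> xy; pose I : set B := [set a | forall s, a * s * y = 0].
pose J : set B := [set b | forall a s, I a -> a * s * b = 0].
have idI : two_sided_ideal I.
  split; first split.
  - by move=> s; rewrite !mul0r.
  - by move=> a b ha hb s; rewrite !mulrDl ha hb addr0.
  - by move=> a b hb s; rewrite -!mulrA [b * _]mulrA hb mulr0.
  - by move=> a b ha s; rewrite -(mulrA a) ha.
have idJ : two_sided_ideal J.
  split; first split.
  - by move=> a s _; rewrite mulr0.
  - by move=> b c hb hc a s Ia; rewrite mulrDr hb // hc // addr0.
  - by move=> c b hb a s Ia; rewrite mulrA -(mulrA a) hb.
  - by move=> b c hb a s Ia; rewrite mulrA hb // mul0r.
have [a b Ia Jb|I0|J0] := primeB idI idJ.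
- by rewrite -[a]mulr1 Jb.
- by left; have : I x by []; rewrite I0.
- right; have : J y by move=> a s; apply.
  by rewrite J0.
Qed.

Hypothesis two_torsion_free : forall x, x + x = 0 -> x = 0.

(** Two exchanges give x s x t y = y s x t x, while the hypothesis at s x t gives the opposite sign;
    so y s (x t x) = 0, and primeness applies twice. *)
Lemma prime_ring_skew x y : (forall s, x * s * y + y * s * x = 0) -> x = 0 \/ y = 0.
Proof.
move=> h; have sk s : x * s * y = - (y * s * x) by apply/eqP; rewrite -addr_eq0 h.
have yxx t : y = 0 \/ x * t * x = 0.
  apply: prime_ring_mul => s; apply: two_torsion_free.
  have e : x * s * (x * t * y) = y * s * (x * t * x).
    by rewrite sk mulrN (mulrA (x * s)) (mulrA (x * s)) sk !mulNr opprK !mulrA.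
  by rewrite -{2}e; have := h (s * x * t); rewrite !mulrA addrC.
have [->|y0] := eqVneq y 0; [by right | left].
have xx t : x * t * x = 0 by case: (yxx t) => // y0'; rewrite y0' eqxx in y0.
by case: (prime_ring_mul xx).
Qed.

End PrimeRings.

(** A group is no union of two proper subgroups: if x misses P and y misses Q, then x + y misses
    both. *)
Lemma subgroup_union (V : zmodType) (P Q : V -> Prop) :
  (forall x y, P x -> P y -> P (x - y)) -> (forall x y, Q x -> Q y -> Q (x - y)) ->
  (forall x, P x \/ Q x) -> (forall x, P x) \/ (forall x, Q x).
Proof.
move=> PB QB PQ; have [|/existsNP[x nPx]] := pselect (forall x, P x); first by left.
have [|/existsNP[y nQy]] := pselect (forall y, Q y); first by right.
have [//|Qx] := PQ x; have [Py|//] := PQ y.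
have [Pxy|Qxy] := PQ (x + y).
- by case: nPx; rewrite -(addrK y x); exact: PB.
- by case: nQy; rewrite -(addrK x y) [y + x]addrC; exact: QB.
Qed.

(** * Linear isomorphisms of the diamond order *)

Section DiamondIsomorphism.
Variables (R : realType) (A B : cstarAlgType R).
Hypotheses (essA : has_essential_socle A) (essB : has_essential_socle B).
Variable T : {linear A -> B}.
Hypothesis Tsurj : forall y : B, exists x : A, T x = y.
Hypothesis Tle : forall x y : A, diamond_le x y <-> diamond_le (T x) (T y).

Local Notation "x ^†" := (star x) (at level 2, format "x ^†").
Implicit Types (u v x y z : A) (k N : R[i]).

Lemma diamond_iso_eq0 x : T x = 0 -> x = 0.
Proof.
move=> Tx0; have : diamond_le (T x) (T 0).
  by rewrite Tx0 linear0; apply/diamond_leP; split; [exists 0; rewrite mulr0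
    | exists 0; rewrite mulr0 | rewrite star0 !mulr0].
by move/Tle/diamond_leP => -[[y ->] _ _]; rewrite mul0r.
Qed.

Lemma diamond_iso_inj : injective T.
Proof.
move=> x y /eqP; rewrite -subr_eq0 -linearB => /eqP/diamond_iso_eq0/eqP.
by rewrite subr_eq0 => /eqP.
Qed.

Lemma diamond_iso_rank_one u : rank_one u <-> rank_one (T u).
Proof.
have T0 x : (T x != 0) = (x != 0).
  by rewrite -[0 in LHS](linear0 T) (inj_eq diamond_iso_inj).
rewrite (rank_oneP _ essA) (rank_oneP _ essB) T0; split=> -[u0 umin]; split=> // x.
- have [a <-] := Tsurj x; move=> /Tle/umin [->|->]; [left | by right].
  exact: linear0.
- move=> /Tle/umin[|] h; [left; exact: diamond_iso_eq0 | right].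
  exact: diamond_iso_inj.
Qed.

(* [good y] holds for invertible y with nonzero coefficient, which scale to
   elements above u; the rest follows by linearity, perturbing 1 to 1 + t y. *)
Lemma diamond_iso_coef u x k : rank_one u ->
  u * x^† * u = k *: (u * u^† * u) ->
  T u * (T x)^† * T u = k *: (T u * (T u)^† * T u).
Proof.
move=> ru hx; have rTu := (diamond_iso_rank_one u).1 ru.
set w := u * u^† * u in hx *; set w' := T u * (T u)^† * T u.
have w0 : w != 0 by apply: contra ru.1 => /eqP/mul_star_mul_eq0 ->.
pose good y := exists2 c, u * y^† * u = c *: w & T u * (T y)^† * T u = c *: w'.
suff [c h1 ->] : good x.
  congr (_ *: _); apply/eqP; rewrite -subr_eq0.
  have /eqP : (c - k) *: w = 0 by rewrite scalerBl -h1 -hx subrr.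
  by rewrite scaler_eq0 (negPf w0) orbF.
have coef y : exists c, u * y^† * u = c *: w.
  have [c hc] := ru.2 y^†; have [N [N0 _ hN]] := rank_one_norm ru.
  by exists (c / N); rewrite /w hN scalerA mulfVK.
have goodD y z : good y -> good z -> good (y + z).
  move=> [c h1 h2] [d h3 h4]; exists (c + d).
    by rewrite starD mulrDr mulrDl h1 h3 scalerDl.
  by rewrite linearD starD mulrDr mulrDl h2 h4 scalerDl.
have goodZ c y : good y -> good (c *: y).
  move=> [d h1 h2]; exists (c^* * d).
    by rewrite star_scale -scalerAr -scalerAl h1 scalerA.
  by rewrite linearZ /= star_scale -scalerAr -scalerAl h2 scalerA.
have goodu : good u by exists 1; rewrite scale1r.
have good_inv y c : invertible y -> u * y^† * u = c *: w -> c != 0 -> good y.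
  move=> [z [zy yz]] hc c0.
  have cc0 : c^* != 0 by rewrite conjC_eq0.
  have uy : diamond_le u ((c^*)^-1 *: y).
    apply/diamond_leP; split.
    - exists (c^* *: (z * u)); rewrite -scalerAl -scalerAr scalerA mulVf //.
      by rewrite scale1r mulrA yz mul1r.
    - exists (c^* *: (u * z)); rewrite -scalerAl -scalerAr scalerA mulfV //.
      by rewrite scale1r -mulrA zy mulr1.
    - have e : ((c^*)^-1)^* = c^-1 by rewrite -fmorphV conjCK.
      rewrite star_scale e -scalerAr -scalerAl hc scalerA mulVf //.
      by rewrite scale1r.
  have -> : y = c^* *: ((c^*)^-1 *: y) by rewrite scalerA mulfV // scale1r.
  apply: goodZ; move/diamond_leP: (uy) => [_ _ h].
  move/Tle/diamond_leP: uy => [_ _ h'].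
  by exists 1; rewrite scale1r -?h -?h'.
have hlin (k1 c1 : R[i]) y t : u * 1^† * u = k1 *: w -> u * y^† * u = c1 *: w ->
    u * (1 + t%:C%C *: y)^† * u = (k1 + t%:C%C * c1) *: w.
  move=> h1 h2; rewrite starD starZR mulrDr mulrDl h1 -scalerAr -scalerAl h2.
  by rewrite scalerA scalerDl.
have R0 (t : R) : 0 < t -> t%:C%C != 0 :> R[i].
  by move=> t0; rewrite fmorph_eq0 gt_eqF.
have [k1 hk1] := coef 1.
have sol y t : 0 < t -> good 1 -> good (1 + t%:C%C *: y) -> good y.
  move=> t0 g1 gy.
  have -> : y = (t%:C%C)^-1 *: ((1 + t%:C%C *: y) + (-1) *: 1).
    by rewrite scaleN1r addrC addKr scalerA mulVf ?R0 // scale1r.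
  by apply/goodZ/goodD => //; apply: goodZ.
have good1 : good 1.
  (* If 1 has coefficient zero, the invertible element 1 + e u has coefficient e. *)
  have [k10|k10] := eqVneq k1 0; last first.
    by apply: good_inv hk1 k10; exists 1; rewrite mulr1.
  have [e e0 he] := invertible_near1 u.
  have g : good (1 + e%:C%C *: u).
    apply: (good_inv _ (k1 + e%:C%C * 1)); first by apply: he; rewrite lexx ltW.
      by apply: hlin => //; rewrite scale1r.
    by rewrite k10 add0r mulr1 R0.
  have -> : 1 = (1 + e%:C%C *: u) + (- e%:C%C) *: u :> A.
    by rewrite scaleNr addrK.
  by apply: goodD => //; apply: goodZ.
have good_nz y c : u * y^† * u = c *: w -> c != 0 -> good y.
  move=> hy c0; have [e e0 he] := invertible_near1 y.
  (* As c is nonzero, k1 + t c cannot vanish at both t = e and t = e / 2. *)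
  have [h|h] := eqVneq (k1 + e%:C%C * c) 0; last first.
    apply: (sol _ e) => //; apply: good_inv (hlin _ _ _ e hk1 hy) h.
    by apply: he; rewrite lexx ltW.
  have e2 : 0 < e / 2 by rewrite divr_gt0.
  apply: (sol _ (e / 2)) => //; apply: good_inv (hlin _ _ _ (e / 2) hk1 hy) _.
    by apply: he; apply/andP; split; lra.
  have -> : k1 + (e / 2)%:C%C * c = - ((e / 2)%:C%C * c).
    have ee : e%:C%C = (e / 2)%:C%C + (e / 2)%:C%C :> R[i].
      by rewrite -rmorphD -splitr.
    by apply/eqP; rewrite -addr_eq0 -addrA -mulrDl -ee h.
  by rewrite oppr_eq0 mulf_neq0 // R0.
have [k0|k0] := eqVneq k 0; last exact: good_nz hx k0.
(* Adding u moves the coefficient from 0 to 1. *)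
have -> : x = (x + u) + (-1) *: u by rewrite scaleN1r addrK.
apply: goodD; last exact: goodZ.
apply: (good_nz _ 1); last exact: oner_neq0.
by rewrite starD mulrDr mulrDl hx k0 scale0r add0r scale1r.
Qed.

(** * Preservation of the triple product, given a common ratio *)

Section Ratio.
Variable rho : R[i].
Hypothesis rhoR : rho^* = rho.
Hypothesis rhoP : forall u N, rank_one u -> u * u^† * u = N *: u ->
  T u * (T u)^† * T u = (rho * N) *: T u.

Lemma rho_norm_neq0 u N : rank_one u -> u * u^† * u = N *: u -> rho * N != 0.
Proof.
move=> ru uuu; have [r0 _] := (diamond_iso_rank_one u).1 ru.
apply: contra r0 => /eqP h; apply/eqP/mul_star_mul_eq0.
by rewrite (rhoP ru uuu) h scale0r.
Qed.

(** For nonzero v, membership in [peirce1] amounts to v and u + v having rank one and u v* u = 0,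
    all of which T preserves. *)
Lemma diamond_iso_peirce1 N u v : rank_one u -> u * u^† * u = N *: u -> N != 0 ->
  peirce1 N u v -> peirce1 (rho * N) (T u) (T v).
Proof.
move=> ru uuu N0 puv.
have [->|v0] := eqVneq v 0; first by left; rewrite linear0 mulr0 mul0r scaler0.
have [rv ruv uvu] := peirce1_rank_one ru uuu N0 puv v0.
apply: rank_one_adjacent.
- exact/diamond_iso_rank_one.
- exact/diamond_iso_rank_one.
- by rewrite -linearD; exact/diamond_iso_rank_one.
- exact: rhoP.
- exact: rho_norm_neq0 uuu.
- by rewrite (@diamond_iso_coef u v 0) // ?scale0r ?uvu.
Qed.

Lemma diamond_iso_peirce1_inv N u v : rank_one u ->
  u * u^† * u = N *: u -> N != 0 ->
  peirce1 (rho * N) (T u) (T v) -> peirce1 N u v.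
Proof.
move=> ru uuu N0 puv.
have [->|v0] := eqVneq v 0; first by left; rewrite mulr0 mul0r scaler0.
have Tv0 : T v != 0 by apply: contra v0 => /eqP/diamond_iso_eq0 ->.
have rTu := (diamond_iso_rank_one u).1 ru.
have [rv ruv uvu] :=
  peirce1_rank_one rTu (rhoP ru uuu) (rho_norm_neq0 ru uuu) puv Tv0.
apply: rank_one_adjacent => //.
- exact/diamond_iso_rank_one.
- by apply/diamond_iso_rank_one; rewrite linearD.
- have [c hc] := ru.2 v^†.
  have e : u * v^† * u = (c / N) *: (u * u^† * u).
    by rewrite hc uuu scalerA mulfVK.
  have := diamond_iso_coef ru e; rewrite uvu (rhoP ru uuu) scalerA => /esym/eqP.
  rewrite scaler_eq0 (negPf rTu.1) orbF mulf_eq0 (negPf (rho_norm_neq0 ru uuu))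
    orbF.
  by move=> /eqP cN; rewrite e cN scale0r.
Qed.

(* Within the orthogonal complement of u, the Peirce space [peirce0 u] is the
   orthogonal complement of the rank-one elements of [peirce1 N u]. *)
Lemma diamond_iso_peirce0 N u v : rank_one u -> u * u^† * u = N *: u -> N != 0 ->
  peirce0 u v -> peirce0 (T u) (T v).
Proof.
move=> ru uuu N0 [uv vu].
have rTu := (diamond_iso_rank_one u).1 ru.
have UUU := rhoP ru uuu; have M0 := rho_norm_neq0 ru uuu.
have uv' : u * v^† = 0 by rewrite -[u]starK -starM vu star0.
have vu' : v^† * u = 0 by rewrite -[u]starK -starM uv star0.
have UVU : T u * (T v)^† * T u = 0.
  by rewrite (@diamond_iso_coef u v 0) // ?uv' ?mul0r scale0r.
have sUVU : (T u)^† * T v * (T u)^† = 0.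
  by have := congr1 star UVU; rewrite !starM starK star0 mulrA.
(* Pull w back to a rank-one a in the Peirce space of u, where a v* a = 0 is immediate. *)
have key w : peirce1 (rho * N) (T u) w -> w * (T v)^† * w = 0.
  have [a <-] := Tsurj w => pw.
  have [->|a0] := eqVneq a 0; first by rewrite linear0 mul0r mulr0.
  have pa := diamond_iso_peirce1_inv ru uuu N0 pw.
  have [ra _ _] := peirce1_rank_one ru uuu N0 pa a0.
  rewrite (@diamond_iso_coef a v 0) ?scale0r //.
  case: pa => -[h _].
  - have vsa : v^† * a = 0.
      have : N *: (v^† * a) = 0 by rewrite scalerAr -h !mulrA vu' !mul0r.
      by move/eqP; rewrite scaler_eq0 (negPf N0) => /eqP.
    by rewrite -mulrA vsa mulr0.
  - have avs : a * v^† = 0.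
      have : N *: (a * v^†) = 0 by rewrite scalerAl -h -!mulrA uv' !mulr0.
      by move/eqP; rewrite scaler_eq0 (negPf N0) => /eqP.
    by rewrite avs mul0r.
split.
(* [key] is applied to this component w of T v itself: w w* w is a multiple of w (T v)* w = 0. *)
- have pw : peirce1 (rho * N) (T u) (T u * (T u)^† * T v).
    left; split; first by rewrite !mulrA UUU -!scalerAl.
    by rewrite -!mulrA [(T u)^† * _]mulrA sUVU mulr0.
  have w0 : T u * (T u)^† * T v = 0.
    have [w wE] : exists w, w = T u * (T u)^† * T v by eexists.
    rewrite -wE in pw *; apply: mul_star_mul_eq0.
    have wU : T u * (T u)^† * w = (rho * N) *: w
      by rewrite wE !mulrA UUU -!scalerAl.
    rewrite {2}wE !starM starK -!mulrA (mulrA (T u)) wU -!scalerAr !mulrA.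
    by rewrite key // scaler0.
  by apply: star_mul_eq0; rewrite starM starK -mulrA [T u * _]mulrA w0 mulr0.
- have pw : peirce1 (rho * N) (T u) (T v * (T u)^† * T u).
    right; split; last by rewrite !mulrA sUVU mul0r.
    by rewrite -!mulrA [(T u) * (_ * _)]mulrA UUU -!scalerAr.
  have w0 : T v * (T u)^† * T u = 0.
    have [w wE] : exists w, w = T v * (T u)^† * T u by eexists.
    rewrite -wE in pw *; apply: mul_star_mul_eq0.
    have wU : w * (T u)^† * T u = (rho * N) *: w.
      by rewrite wE -!mulrA [(T u) * (_ * _)]mulrA UUU -!scalerAr.
    by rewrite {2}wE !starM starK !mulrA wU -!scalerAl key // scaler0.
  by apply: mul_star_eq0; rewrite starM starK mulrA w0 mul0r.
Qed.

(** The defect of the triple identity: linear in the outer arguments and conjugate-linear in the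
    middle one, so it can be killed on Peirce components. *)
Let D x y z : B := triple (T x) (T y) (T z) - rho *: T (triple x y z).

Lemma defectC x y z : D x y z = D z y x.
Proof. by rewrite /D (tripleC (T x)) (tripleC x). Qed.

Lemma defectDl x x' y z : D (x + x') y z = D x y z + D x' y z.
Proof. by rewrite /D linearD !tripleDl linearD scalerDr opprD addrACA. Qed.

Lemma defectZl c x y z : D (c *: x) y z = c *: D x y z.
Proof.
by rewrite /D linearZ /= !tripleZl [T (_ *: _)]linearZ /= scalerBr !scalerA [rho
  * c]mulrC.
Qed.

Lemma defectDr x y z z' : D x y (z + z') = D x y z + D x y z'.
Proof. by rewrite ![D x y _]defectC defectDl. Qed.

Lemma defectZr c x y z : D x y (c *: z) = c *: D x y z.
Proof. by rewrite ![D x y _]defectC defectZl. Qed.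

Lemma defectDm x y y' z : D x (y + y') z = D x y z + D x y' z.
Proof. by rewrite /D linearD !tripleDm linearD scalerDr opprD addrACA. Qed.

Lemma defectZm c x y z : D x (c *: y) z = c^* *: D x y z.
Proof.
by rewrite /D linearZ /= !tripleZm [T (_ *: _)]linearZ /= scalerBr !scalerA [rho
  * _]mulrC.
Qed.

(** [triple u u] acts on the Peirce components of u by the scalars 2 N, N and 0; T respects the
    components, with N replaced by rho N. *)
Lemma defect_diag u z : rank_one u -> D u u z = 0.
Proof.
move=> ru; have [N [N0 NR uuu]] := rank_one_norm ru.
have [c [v1 [v1' [v0 [-> p1 p1' p0]]]]] := peirce_decomposition z ru uuu N0 NR.
have D1 v : peirce1 N u v -> D u u v = 0.
  move=> pv; have pTv := diamond_iso_peirce1 ru uuu N0 pv.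
  by rewrite /D (triple_peirce1 pv) (triple_peirce1 pTv) [T (_ *: _)]linearZ /=
    scalerA subrr.
have D0 v : peirce0 u v -> D u u v = 0.
  move=> pv; have pTv := diamond_iso_peirce0 ru uuu N0 pv.
  by rewrite /D (triple_peirce0 0 pv).2 (triple_peirce0 0 pTv).2 linear0 scaler0
    subrr.
have D2 : D u u u = 0.
  by rewrite /D /triple uuu (rhoP ru uuu) [T (_ + _)]linearD [T (_ *: _)]linearZ
    /= scalerDr !scalerA subrr.
by rewrite !defectDr defectZr D2 D1 // D1 // D0 // scaler0 !addr0.
Qed.

(** Polarization of [defect_diag]: for v in the Peirce space [peirce1], the elements u + v and u + i
    v have rank one, and conjugate-linearity in the middle separates D u v z from D v u z. *)
Lemma defect_rank_one u y z : rank_one u -> D u y z = 0.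
Proof.
move=> ru; have [N [N0 NR uuu]] := rank_one_norm ru.
have [c [v1 [v1' [v0 [-> p1 p1' p0]]]]] := peirce_decomposition y ru uuu N0 NR.
have D1 v : peirce1 N u v -> D u v z = 0.
  move=> pv; have [->|v0'] := eqVneq v 0.
    by rewrite -(scale0r (0 : A)) defectZm conjC0 scale0r.
  have polar w : peirce1 N u w -> w != 0 -> D u w z + D w u z = 0.
    move=> pw w0; have [rw ruw _] := peirce1_rank_one ru uuu N0 pw w0.
    have := defect_diag z ruw; rewrite defectDl !defectDm !defect_diag //.
    by rewrite add0r addr0.
  have i0 : 'i != 0 :> R[i] by exact: neq0Ci.
  have := polar _ pv v0'; have := polar ('i *: v) (peirce1Z 'i pv).
  rewrite scaler_eq0 negb_or i0 v0' => /(_ isT).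
  rewrite defectZm defectZl conjCi scaleNr => /eqP.
  rewrite addrC subr_eq0 => /eqP/(scalerI i0) ->.
  by rewrite -mulr2n => /eqP; rewrite -scaler_nat scaler_eq0 pnatr_eq0 => /eqP.
have D0 v : peirce0 u v -> D u v z = 0.
  move=> pv; have pTv := diamond_iso_peirce0 ru uuu N0 pv.
  by rewrite /D (triple_peirce0 _ pv).1 (triple_peirce0 _ pTv).1 linear0 scaler0
    subrr.
by rewrite !defectDm defectZm defect_diag // D1 // D1 // D0 // scaler0 !addr0.
Qed.

Lemma diamond_iso_quadratic u x : rank_one u ->
  T u * (T x)^† * T u = rho *: T (u * x^† * u).
Proof.
move=> ru; have /eqP := defect_rank_one x u ru.
rewrite subr_eq0 /triple -!mulr2n linearMn -scalerMnr => /eqP h.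
have n2 : (2%:R : R[i]) != 0 by rewrite pnatr_eq0.
by apply: (scalerI n2); rewrite !scaler_nat.
Qed.

(** Test the defect against every rank-one T u: [triple_quadratic] reduces both sides to triples
    with a multiple of u as an outer argument. *)
Lemma diamond_iso_triple x y z :
  triple (T x) (T y) (T z) = rho *: T (triple x y z).
Proof.
apply/eqP; rewrite -subr_eq0; apply/eqP.
apply: (rank_one_separating essB) => U rU.
have [u uU] := Tsurj U; rewrite -uU in rU *.
have ru := (diamond_iso_rank_one u).2 rU.
have eqD a b c : D a b c = 0 -> triple (T a) (T b) (T c) = rho *: T (triple a b c).
  by move/eqP; rewrite subr_eq0 => /eqP.
have e1 a b : triple (T u) (T a) (T b) = rho *: T (triple u a b).
  exact/eqD/defect_rank_one.
have [c hc] := ru.2 x^†.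
have e2 : triple (T (u * x^† * u)) (T z) (T y) = rho *: T (triple (u * x^† * u) z
  y).
  by apply: eqD; rewrite hc defectZl defect_rank_one ?scaler0.
have e3 : triple (T y) (T z) (T u) = rho *: T (triple y z u).
  by apply: eqD; rewrite defectC defect_rank_one.
rewrite starB mulrBr mulrBl star_scale -scalerAr -scalerAl rhoR.
rewrite (diamond_iso_quadratic _ ru) !triple_quadratic e3 (tripleC _ _ (rho *:
  _)) tripleZl (tripleC _ _ (T u)) e1.
by rewrite (diamond_iso_quadratic _ ru) tripleZl e2 [T (_ - _)]linearB !scalerBr
  subrr.
Qed.

End Ratio.

(** * Constancy of the ratio over a prime algebra *)

Hypothesis primeB : prime_ring B.

(** For u of rank one, r is the squared norm of T u divided by that of u. *)
Let ratio u (r : R[i]) := exists N,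
  [/\ N != 0, u * u^† * u = N *: u & T u * (T u)^† * T u = (r * N) *: T u].

(** By [rank_one_coef] the coefficients of u v* u and v u* v are conjugate, and so are those of
    their images. [diamond_iso_coef] scales the first by the ratio at u and the second by the ratio
    at v. *)
Lemma ratio_nonorthogonal u v r : rank_one u -> rank_one v ->
  T u * (T v)^† * T u != 0 -> ratio u r -> ratio v r.
Proof.
move=> ru rv uv0 [N [N0 uuu UUU]].
have rU := (diamond_iso_rank_one u).1 ru; have rV := (diamond_iso_rank_one v).1 rv.
have [M [M0 MR vvv]] := rank_one_norm rv;
  have [M' [M'0 M'R VVV]] := rank_one_norm rV.
have [a ha] := ru.2 v^†; have [b hb] := rv.2 u^†.
have ea : u * v^† * u = (a / N) *: (u * u^† * u).
  by rewrite ha uuu scalerA mulfVK.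
have eb : v * u^† * v = (b / M) *: (v * v^† * v).
  by rewrite hb vvv scalerA mulfVK.
have hA := diamond_iso_coef ru ea; have hB := diamond_iso_coef rv eb.
rewrite UUU scalerA in hA; rewrite VVV scalerA in hB.
have k0 : a != 0.
  by apply: contra uv0 => /eqP a0; rewrite hA a0 !mul0r scale0r.
have UV0 : T u * (T v)^† != 0.
  by apply: contra uv0 => /eqP ->; rewrite mul0r.
have uv1 : u * v^† != 0.
  apply: contra k0 => /eqP h; have := ha; rewrite h mul0r => /esym/eqP.
  by rewrite scaler_eq0 (negPf ru.1) orbF.
have c1 := rank_one_coef uv1 ha hb; have c2 := rank_one_coef UV0 hA hB.
exists M; split=> //; rewrite VVV; congr (_ *: _).
apply: (mulfI k0); rewrite mulrA; apply: (mulIf (invr_neq0 M0)).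
rewrite mulfK //.
have -> : a * r = a / N * (r * N) by rewrite mulrCA mulfVK // mulrC.
rewrite c2 c1 !rmorphM fmorphV /= -!mulrA; congr (_ * _); rewrite mulrC.
by congr (_^-1 * _).
Qed.

(** When T u and T v are orthogonal, u + v serves as an intermediary orthogonal to neither. *)
Lemma ratio_adjacent u v r : rank_one u -> rank_one v ->
  (T u + T v != 0 -> rank_one (T u + T v)) -> ratio u r -> ratio v r.
Proof.
move=> ru rv ruv hu.
have [uv0|] := eqVneq (T u * (T v)^† * T u) 0; last first.
  by move=> h; exact: ratio_nonorthogonal hu.
have rU := (diamond_iso_rank_one u).1 ru; have rV := (diamond_iso_rank_one v).1 rv.
have vu0 := rank_one_sym rV uv0.
have us : T u * (T (u + v))^† * T u != 0.
  rewrite linearD starD mulrDr mulrDl uv0 addr0.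
  by apply: contra rU.1 => /eqP/mul_star_mul_eq0 ->.
have s0 : T u + T v != 0.
  by apply: contra us => /eqP h; rewrite linearD h star0 mulr0 mul0r.
have rs : rank_one (u + v) by apply/diamond_iso_rank_one; rewrite linearD;
  exact: ruv.
have hs := ratio_nonorthogonal ru rs us hu.
apply: ratio_nonorthogonal hs => //; apply/negP => /eqP h.
have /eqP := rank_one_sym rV h; rewrite linearD starD mulrDr mulrDl vu0 add0r.
by move=> /eqP/mul_star_mul_eq0 V0; move: rV.1; rewrite V0 eqxx.
Qed.

(** Primeness gives a nonzero w' = T u c T v. The sums T u + w' and w' + T v are multiples of T u on
    the right and of T v on the left, so both pairs are adjacent. *)
Lemma ratio_const u v r : rank_one u -> rank_one v -> ratio u r -> ratio v r.
Proof.
move=> ru rv; have rU := (diamond_iso_rank_one u).1 ru.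
have rV := (diamond_iso_rank_one v).1 rv.
have [c UcV0] : exists c, T u * c * T v != 0.
  apply: contrapT => nex; have [] := @prime_ring_mul _ primeB (T u) (T v).
  - by move=> c; apply/eqP; apply: contra_notT nex => h; exists c.
  - by move=> U0; move: rU.1; rewrite U0 eqxx.
  - by move=> V0; move: rV.1; rewrite V0 eqxx.
have [w wE] := Tsurj (T u * c * T v).
have rw : rank_one w.
  by apply/diamond_iso_rank_one; rewrite wE; exact: rank_oneMl.
move=> /(ratio_adjacent ru rw) hu; apply: (ratio_adjacent rw rv).
- have -> : T w + T v = (T u * c + 1) * T v by rewrite wE mulrDl mul1r.
  exact: rank_oneMl.
- apply: hu; have -> : T u + T w = T u * (1 + c * T v).
    by rewrite wE mulrDr mulr1 mulrA.
  exact: rank_oneMr.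
Qed.

Lemma diamond_iso_triple_ex : exists rho, [/\ rho != 0, rho^* = rho &
  forall x y z, triple (T x) (T y) (T z) = rho *: T (triple x y z)].
Proof.
have [u ru _] := exists_rank_one_le essA (oner_neq0 A).
have [N [N0 NR uuu]] := rank_one_norm ru.
have [M [M0 MR UUU]] := rank_one_norm ((diamond_iso_rank_one u).1 ru).
have hu : ratio u (M / N) by exists N; rewrite mulfVK.
have rR : (M / N)^* = M / N.
  by rewrite rmorphM fmorphV /=; congr (_ * _^-1).
exists (M / N); split; first by rewrite mulf_neq0 // invr_eq0.
  exact: rR.
apply: diamond_iso_triple => // v K rv vvv.
have [L [L0 vvv' ->]] := ratio_const ru rv hu.
congr ((_ * _) *: _); apply/eqP; rewrite -subr_eq0.
have /eqP : (L - K) *: v = 0 by rewrite scalerBl -vvv -vvv' subrr.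
by rewrite scaler_eq0 (negPf rv.1) orbF.
Qed.

End DiamondIsomorphism.

(** * Jordan homomorphisms *)

Section JordanStar.
Variables (R : realType) (A B : cstarAlgType R) (S : A -> B).
Hypotheses (primeB : prime_ring B) (S_lin : linear S).
Hypothesis S_surj : forall y : B, exists x : A, S x = y.
Hypothesis S_triple : forall x y z,
  S (triple x y z) = triple (S x) (S y) (S z).
Hypotheses (S_star : {morph S : x / star x}) (S1 : S 1 = 1).
Implicit Types x y z : A.

Let S_add x y : S (x + y) = S x + S y.
Proof. by have := S_lin 1 x y; rewrite !scale1r. Qed.

Let S_sub x y : S (x - y) = S x - S y.
Proof. by have := S_lin (-1) y x; rewrite !scaleN1r ![- _ + _]addrC. Qed.

Let torsion_free (a b : B) : a + a = b + b -> a = b.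
Proof.
have n2 : (2%:R : R[i]) != 0 by rewrite pnatr_eq0.
by rewrite -!mulr2n => h; apply: (scalerI n2); rewrite !scaler_nat.
Qed.

Lemma jordan_square x y : S (x * y) + S (y * x) = S x * S y + S y * S x.
Proof.
have := S_triple x 1 y.
by rewrite /triple S1 !star1 !mulr1 S_add.
Qed.

Lemma jordan_triple x y z :
  S (x * y * z) + S (z * y * x) = S x * S y * S z + S z * S y * S x.
Proof.
have := S_triple x (star y) z.
by rewrite /triple S_star !starK S_add.
Qed.

Lemma jordan_quadratic x y : S (x * y * x) = S x * S y * S x.
Proof. by apply: torsion_free; exact: jordan_triple. Qed.

(** Computing S (x y t y x + y x t x y) by [jordan_triple] and by [jordan_quadratic] shows that X -
    P and X - Q satisfy the identity of [prime_ring_skew]. *)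
Lemma jordan_defect x y : S (x * y) = S x * S y \/ S (x * y) = S y * S x.
Proof.
set X := S (x * y); set P := S x * S y; set Q := S y * S x.
suff [/eqP|/eqP] : X - P = 0 \/ X - Q = 0.
- by rewrite subr_eq0 => /eqP; left.
- by rewrite subr_eq0 => /eqP; right.
apply: (prime_ring_skew primeB) => [b b0|s].
  by apply: torsion_free; rewrite b0 addr0.
have [t <-] := S_surj s.
have YE : S (y * x) = P + Q - X
  by rewrite /P /Q -jordan_square [S (x * y) + _]addrC addrK.
have := jordan_triple (x * y) t (y * x).
have -> : x * y * t * (y * x) = x * (y * t * y) * x by rewrite !mulrA.
have -> : y * x * t * (x * y) = y * (x * t * x) * y by rewrite !mulrA.
rewrite !jordan_quadratic YE.
have -> : S x * (S y * S t * S y) * S x = P * S t * Q by rewrite /P /Q !mulrA.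
have -> : S y * (S x * S t * S x) * S y = Q * S t * P by rewrite /P /Q !mulrA.
rewrite -/X; move: (S t) => u h.
rewrite -[RHS](subrr (P * u * Q + Q * u * P)) {2}h.
rewrite !(mulrBl, mulrBr, mulrDl, mulrDr) !(opprD, opprB, opprK) !addrA.
by rewrite [LHS](AC 8 (((((((4*8)*7)*3)*1)*2)*6)*5)).
Qed.

(** [subgroup_union] makes the alternative of [jordan_defect] uniform, first in y for fixed x, then
    in x. *)
Lemma jordan_hom_or_antihom :
  {morph S : x y / x * y} \/ (forall x y, S (x * y) = S y * S x).
Proof.
have hom1 x : (forall y, S (x * y) = S x * S y) \/ (forall y, S (x * y) = S y * S
  x).
  apply: subgroup_union => [y z hy hz|y z hy hz|]; last exact: jordan_defect.
  - by rewrite mulrBr !S_sub hy hz mulrBr.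
  - by rewrite mulrBr !S_sub hy hz mulrBl.
apply: (subgroup_union (P := fun x => forall y, S (x * y) = S x * S y)
  (Q := fun x => forall y, S (x * y) = S y * S x)) => // x z hx hz y.
- by rewrite mulrBl !S_sub hx hz mulrBl.
- by rewrite mulrBl !S_sub hx hz mulrBr.
Qed.

End JordanStar.

(** * Scaled unitaries and star-isomorphisms preserve the diamond order *)

Section SufficientCondition.
Variables (R : realType) (A B : cstarAlgType R).
Implicit Types a b : A.

(** With g the inverse of h, right factors are unchanged, left factors y become h y g, and both
    sides of the equation are multiplied by rho h. *)
Lemma diamond_le_scaled_unitary (rho : R[i]) (h c d : B) : rho != 0 ->
  h * star h = rho *: 1 -> star h * h = rho *: 1 ->
  diamond_le (h * c) (h * d) <-> diamond_le c d.
Proof.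
move=> r0 hh' h'h.
have [g gh hg] : exists2 g, g * h = 1 & h * g = 1.
  exists (rho^-1 *: star h).
    by rewrite -scalerAl h'h scalerA mulVf // scale1r.
  by rewrite -scalerAr hh' scalerA mulVf // scale1r.
have hI x y : h * x = h * y -> x = y.
  by move=> e; rewrite -[x]mul1r -gh -mulrA e mulrA gh mul1r.
have hcd x : h * c * star (h * x) * (h * c) = rho *: (h * (c * star x * c)).
  rewrite starM -!mulrA [star h * (h * _)]mulrA h'h -scalerAl mul1r.
  by rewrite -!scalerAr.
rewrite !diamond_leP !hcd; split=> -[[x xE] [y yE] e]; split.
- by exists x; apply: hI; rewrite xE mulrA.
- by exists (g * y * h); rewrite -[c]mul1r -gh -!mulrA -yE.
- by apply: hI; exact: (scalerI r0).
- by exists x; rewrite xE mulrA.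
- by exists (h * y * g); rewrite yE -!mulrA [g * _]mulrA gh mul1r.
- by rewrite e.
Qed.

Lemma star_isomorphism_diamond_le (S : A -> B) a b : star_isomorphism S ->
  diamond_le (S a) (S b) <-> diamond_le a b.
Proof.
move=> [_ [S' SK S'K] SM Sstar].
rewrite !diamond_leP -!Sstar -!SM; split=> -[[x xE] [y yE] e]; split.
- by exists (S' x); apply: (can_inj SK); rewrite SM S'K.
- by exists (S' y); apply: (can_inj SK); rewrite SM S'K.
- exact: (can_inj SK).
- by exists (S x); rewrite xE SM.
- by exists (S y); rewrite yE SM.
- by rewrite e.
Qed.

(** The two inclusions trade places, and the products a a* a and a b* a read the same backwards. *)
Lemma star_anti_isomorphism_diamond_le (S : A -> B) a b : star_anti_isomorphism S ->
  diamond_le (S a) (S b) <-> diamond_le a b.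
Proof.
move=> [_ [S' SK S'K] SM Sstar].
rewrite !diamond_leP -!Sstar -!SM !mulrA; split=> -[[x xE] [y yE] e]; split.
- by exists (S' y); apply: (can_inj SK); rewrite SM S'K.
- by exists (S' x); apply: (can_inj SK); rewrite SM S'K.
- exact: (can_inj SK).
- by exists (S y); rewrite yE SM.
- by exists (S x); rewrite xE SM.
- by rewrite e.
Qed.

End SufficientCondition.

(** * From the triple identity to the factorization *)

(** For a minimal projection p, (h p)* (h p) = rho p, and [minimal_projection_ge0] gives the
    sign. *)
Lemma scalar_positive (R : realType) (B : cstarAlgType R) (rho : R[i]) (h : B) :
  has_essential_socle B -> rho != 0 -> star h * h = rho *: 1 ->
  exists2 k : R, 0 < k & rho = k%:C%C.
Proof.
move=> essB r0 h'h.
have [p [_ [pmin _]]] := essential_socle_projection essB (oner_neq0 B).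
have [pp sp p0 _] := pmin.
have hpp : h * p * p = h * p by rewrite -mulrA pp.
have [k k0] := minimal_projection_ge0 pmin hpp.
rewrite starM sp -mulrA [star h * _]mulrA h'h -scalerAl mul1r -scalerAr pp => /eqP.
rewrite -subr_eq0 -scalerBl scaler_eq0 (negPf p0) orbF subr_eq0 => /eqP rk.
exists k => //; rewrite lt_neqAle k0 andbT eq_sym.
by apply: contra r0 => /eqP k00; rewrite rk k00.
Qed.

Lemma triple_hom_star_hom (R : realType) (A B : cstarAlgType R)
  (primeB : prime_ring B) (T : {linear A -> B}) (rho : R[i]) :
  rho != 0 -> rho^* = rho -> bijective T ->
  (forall x y z, triple (T x) (T y) (T z) = rho *: T (triple x y z)) ->
  [/\ T 1 * star (T 1) = rho *: 1, star (T 1) * T 1 = rho *: 1 &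
    exists2 S : A -> B, star_isomorphism S \/ star_anti_isomorphism S &
      forall x, T x = T 1 * S x].
Proof.
move=> r0 rR [T' TK T'K] Ttriple; set h := T 1.
have J1 x : h * star (T x) * h = rho *: T (star x).
  have n2 : (2%:R : R[i]) != 0 by rewrite pnatr_eq0.
  apply: (scalerI n2); rewrite !scaler_nat !mulr2n.
  have := Ttriple 1 x 1; rewrite /triple mulr1 mul1r => ->.
  by rewrite linearD scalerDr.
(* [J1] at x = (T' 1)* has right-hand side rho 1, so h is invertible on both sides. *)
have [w hw] : exists w, h * w = 1.
  exists (rho^-1 *: (star (T (star (T' 1))) * h)).
  by rewrite -scalerAr mulrA J1 starK T'K scalerA mulVf // scale1r.
have [z zh] : exists z, z * h = 1.
  exists (rho^-1 *: (h * star (T (star (T' 1))))).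
  by rewrite -scalerAl J1 starK T'K scalerA mulVf // scale1r.
have hhh : h * star h * h = rho *: h by have := J1 1; rewrite star1.
have hh' : h * star h = rho *: 1.
  by rewrite -[LHS]mulr1 -{1}hw mulrA hhh -scalerAl hw.
have h'h : star h * h = rho *: 1.
  by rewrite -[LHS]mul1r -{1}zh -!mulrA [h * _]mulrA hhh -!scalerAr zh.
split=> //.
pose S x := rho^-1 *: (star h * T x).
have TS x : T x = h * S x.
  by rewrite -scalerAr mulrA hh' -scalerAl mul1r scalerA mulVf // scale1r.
have SK y : S (T' (h * y)) = y.
  by rewrite /S T'K mulrA h'h -scalerAl mul1r scalerA mulVf // scale1r.
have S_lin : linear S.
  move=> c x y; rewrite /S linearP mulrDr scalerDr -scalerAr; congr (_ + _).
  by rewrite !scalerA mulrC.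
have S_bij : bijective S.
  by exists (fun y => T' (h * y)) => [x|//]; rewrite -TS TK.
have S_star : {morph S : x / star x}.
  move=> x; rewrite /S -[T (star x)]scale1r -(mulVf r0) -scalerA -J1.
  have rV : (rho^-1)^* = rho^-1 by rewrite fmorphV; congr (_^-1).
  rewrite star_scale rV starM starK -!scalerAr !mulrA h'h -!scalerAl mul1r.
  by congr (_ *: _); rewrite scalerA mulVf // scale1r.
have S1 : S 1 = 1 by rewrite /S h'h scalerA mulVf // scale1r.
clearbody S; have S_triple x y t : S (triple x y t) = triple (S x) (S y) (S t).
  have : rho *: (h * S (triple x y t)) = rho *: (h * triple (S x) (S y) (S t)).
    rewrite -TS -Ttriple !TS /triple !starM -!mulrA ![star h * (h * _)]mulrA h'h.
    by rewrite -!scalerAl !mul1r -!scalerAr mulrDr scalerDr.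
  move/(scalerI r0) => e; rewrite -[LHS]mul1r -[RHS]mul1r -zh.
  by rewrite -!mulrA e.
exists S => //.
have [hom|anti] := jordan_hom_or_antihom primeB S_lin
  (fun y => ex_intro _ _ (SK y)) S_triple S_star S1; [by left | by right].
Qed.

Unset Implicit Arguments.

Local Open Scope complex_scope.

Theorem theorem3p3 (R : realType) (A B : cstarAlgType R)
    (socA : has_essential_socle A) (socB : has_essential_socle B)
    (primeB : prime_ring B)
    (T : {linear A -> B}) (surjT : forall y : B, exists x : A, T x = y) :
  let h : B := T 1 in
  (forall a b : A, diamond_le a b <-> diamond_le (T a) (T b)) <->
  (exists lambda : R,
    [/\ 0 < lambda,
        h * star h = lambda%:C *: 1,
        star h * h = lambda%:C *: 1 &
        exists2 S : A -> B,
          star_isomorphism S \/ star_anti_isomorphism S &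
          forall x : A, T x = h * S x]).
Proof.
move=> h; split=> [Tle | [lambda [l0 hh' h'h [S HS TS]]] a b].
- have [rho [r0 rR Ttriple]] := diamond_iso_triple_ex socA socB surjT Tle primeB.
  have Tinj := diamond_iso_inj Tle.
  have [T' T'K] := choice surjT.
  have Tbij : bijective T.
    by exists T' => // x; apply: Tinj; rewrite T'K.
  have [hh' h'h exS] := triple_hom_star_hom primeB r0 rR Tbij Ttriple.
  have [lambda l0 rl] := scalar_positive socB r0 h'h.
  by exists lambda; rewrite -rl.
- have r0 : lambda%:C != 0 by rewrite fmorph_eq0 gt_eqF.
  rewrite !TS (diamond_le_scaled_unitary _ _ r0 hh' h'h).
  case: HS => HS; first by rewrite (star_isomorphism_diamond_le _ _ HS).
  by rewrite (star_anti_isomorphism_diamond_le _ _ HS).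
Qed.
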